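(* Let $d\geq 1$ and let $Z_k=(X_k,Y_k)$, $k\geq 1$, be random variables, defined on a common probability space, with values in $[0,1]^d\times[0,1]^d$, such that $X_k$ and $Y_k$ have the same distribution for every $k\geq 1$. If the associated mixing sequence $\alpha(\ell)$, $\ell\geq 1$, is summable, i.e. $\sum_{\ell\ge 1}\alpha(\ell)<\infty$, then the empirical measures $\mu_n=\frac1n\sum_{k=1}^n\delta_{X_k}$ and $\nu_n=\frac1n\sum_{k=1}^n\delta_{Y_k}$ satisfy, as $n\to\infty$, $$ \mathbb{E}\big(\mathrm{W}_1(\mu_n,\nu_n)\big) = \begin{cases} O\big(\frac{1}{\sqrt n}\big) & \text{if } d=1,\\ O\Big(\sqrt{\frac{\log n}{n}}\Big) & \text{if } d=2,\\ O\big(\frac{1}{n^{1/d}}\big) & \text{if } d\geq 3. \end{cases} $$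
   Context: For Borel probability measures $\mu,\nu$ on $\mathbb{R}^d$ with finite first moment, $\mathrm{W}_1(\mu,\nu)=\inf_\lambda \int_{\mathbb{R}^d}\int_{\mathbb{R}^d}|x-y|\,d\lambda(x,y)$, where the infimum is over all probability measures $\lambda$ on $\mathbb{R}^d\times\mathbb{R}^d$ with marginals $\mu$ and $\nu$, and $|\cdot|$ is the Euclidean norm. On a probability space $(\Omega,\mathcal{A},\mathbb{P})$, for $\sigma$-algebras $\mathcal{A}_1,\mathcal{A}_2\subset\mathcal{A}$, the Rosenblatt coefficient is $\alpha(\mathcal{A}_1,\mathcal{A}_2)=\sup\{|\mathbb{P}(A_1\cap A_2)-\mathbb{P}(A_1)\mathbb{P}(A_2)| : A_1\in\mathcal{A}_1,\ A_2\in\mathcal{A}_2\}$. Let $\mathcal{A}_k$ be the $\sigma$-algebra generated by $Z_k$. The mixing sequence associated with $(Z_k)_{k\geq1}$ is $\alpha(\ell)=\sup_{|j-k|\geq\ell}\alpha(\mathcal{A}_j,\mathcal{A}_k)$, $\ell\geq1$, where the supremum is over $j,k\geq 1$. *)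

(* Defs.v *)
From HB Require Import structures.
From mathcomp Require Import all_boot all_order all_algebra.
From mathcomp Require Import all_classical all_reals all_analysis.

Set Implicit Arguments.
Unset Strict Implicit.
Unset Printing Implicit Defensive.

Import Order.TTheory GRing.Theory Num.Theory.
Import numFieldNormedType.Exports.

Local Open Scope classical_set_scope.
Local Open Scope ring_scope.

(* R^d is represented by [d.-tuple R]: its product sigma-algebra, generated by
   the coordinates, is the Borel sigma-algebra of R^d. *)

Definition edist (R : realType) (d : nat) (x y : d.-tuple R) : R :=
  Num.sqrt (\sum_(i < d) (tnth x i - tnth y i) ^+ 2).

(* Measures are total functions on [set _], meaningful on measurable sets only,
   hence the restriction to measurable [A]. *)
Definition coupling (R : realType) (d : nat)
    (mu nu : {measure set (d.-tuple R) -> \bar R}) :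
    set (probability (d.-tuple R * d.-tuple R)%type R) :=
  [set lambda |
    (forall A : set (d.-tuple R), measurable A ->
       lambda (fst @^-1` A) = mu A) /\
    (forall A : set (d.-tuple R), measurable A ->
       lambda (snd @^-1` A) = nu A)].

(* Only meaningful when [mu] and [nu] have mass 1; otherwise there is no
   coupling and the value is +oo. *)
Definition W1 (R : realType) (d : nat)
    (mu nu : {measure set (d.-tuple R) -> \bar R}) : \bar R :=
  ereal_inf [set (\int[lambda]_z (edist z.1 z.2)%:E)%E
            | lambda in coupling mu nu].

(* A probability measure for n > 0 (see [empiricalT]), the null measure for
   n = 0. *)
Definition empirical (R : realType) (d : nat) (x : nat -> d.-tuple R)
    (n : nat) : {measure set (d.-tuple R) -> \bar R} :=
  mscale ((n%:R : R)^-1)%:nng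
    (msum (fun k => dirac (x k) : {measure set (d.-tuple R) -> \bar R}) n).

Lemma empiricalT (R : realType) (d : nat) (x : nat -> d.-tuple R) (n : nat) :
  (0 < n)%N -> empirical x n [set: d.-tuple R] = 1%E.
Proof.
move=> n0; rewrite /empirical /= /mscale /= /msum /=.
under eq_bigr do rewrite diracT.
rewrite sumEFin sumr_const card_ord -EFinM mulVf//.
by rewrite pnatr_eq0 -lt0n.
Qed.

Definition rosenblatt (disp : measure_display) (T : measurableType disp)
    (R : realType) (P : probability T R) (G1 G2 : set (set T)) : \bar R :=
  ereal_sup [set x | exists A1 A2 : set T,
    [/\ G1 A1, G2 A2 & x = `|P (A1 `&` A2) - P A1 * P A2|%E]].

(* Sequences are indexed from 0 ([Z k] stands for Z_{k+1}); this
   leaves the constraint on |j - k| unchanged. *)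
Definition mixing (disp : measure_display) (T : measurableType disp)
    (R : realType) (P : probability T R)
    (disp' : measure_display) (V : measurableType disp')
    (Z : nat -> T -> V) (l : nat) : \bar R :=
  ereal_sup [set x | exists j k : nat, (l <= `|j - k|)%N /\
    x = rosenblatt P (g_sigma_algebra_preimage (Z j))
                     (g_sigma_algebra_preimage (Z k))].

Definition rate (R : realType) (d n : nat) : R :=
  if d == 1%N then 1 / Num.sqrt n%:R
  else if d == 2%N then Num.sqrt (ln n%:R / n%:R)
  else 1 / (n%:R `^ (1 / d%:R)).

(* Main.v *)
From Pilot Require Import Defs.
From HB Require Import structures.
From mathcomp Require Import all_boot all_order all_algebra.
From mathcomp Require Import all_classical all_reals all_analysis.
From mathcomp Require Import measurable_realfun.
From mathcomp Require Import perm ring lra zify.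

Set Implicit Arguments.
Unset Strict Implicit.
Unset Printing Implicit Defensive.

Import Order.TTheory GRing.Theory Num.Theory.
Import numFieldNormedType.Exports.

Local Open Scope classical_set_scope.
Local Open Scope ring_scope.

(** The proof is a discrete version of the Fourier-analytic bound of Bobkov and
Ledoux for [W1].

Fix an outcome.  A permutation matching the points [x_i] to the points [y_i]
with least cost defines a coupling of the two empirical measures, and duality
for the assignment problem ([assignment_duality]) provides a 1-Lipschitz
function [f] for which the cost is at most [1/n sum_i (f(y_i) - f(x_i))].
Rounding the points to a grid of mesh [1/M] costs [2 d / M].  On the grid, [f]
and the signed measure [D], the rounded difference of the two empirical
measures, are expanded in products of discrete cosines.  Both this basis and
the family of its discrete gradients are orthogonal, the gradient of the
element of frequency [k] having squared norm [lambda_k >= |k|^2 / M^2].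
Therefore the pairing of [f] with [D] is controlled, through the inequality
[a b <= t a^2 / 2 + b^2 / (2 t)], by the Dirichlet energy of [f], which is at
most [d M^(d-2)] for a Lipschitz function, and by the sum over the nonzero
frequencies of [D^(k)^2 / lambda_k] ([grid_dual_bound]).  Once [t] is well
chosen, all the scales are thus added under one square root.  Adding instead one
bound per scale of a dyadic partition would give [log n / sqrt n] in dimension
2.

Each coefficient [D^(k)] is an empirical mean of values [phi_k (Z_j)], centered
because [X_j] and [Y_j] have the same law, and bounded by a multiple of
[M^(-d/2)] because cosines are bounded.  Strong mixing bounds the covariance of
bounded functions of [Z_i] and [Z_j] by a multiple of [alpha(|i - j|)]
([mixing_covariance]), so that the second moment of [D^(k)] is
[O(M^(-d) / n)] ([square_mean_bound]).

Taking expectations with [t] proportional to [tau M^(2-d)], the mean of [W1] is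
at most a constant times [1 / M + tau + S / (n tau)], where [S] is the sum of
[1 / |k|^2] over the nonzero [k] in [{0, ..., M-1}^d] ([expected_W1_le]).  As
[S] is [O(1)], [O(log M)] or [O(M^(d-2))] according to the dimension, the
theorem follows with [tau] equal to the announced rate, [M = n + 1] if [d <= 2]
and [M] of order [n^(1/d)] otherwise ([grid_size_rate]). *)

(* [edist] is also the name of the extended distance of a pseudometric space. *)
Local Notation edist := Pilot.Defs.edist.

(** * Duality for the assignment problem *)

Section NoNegativeCycle.
Context {R : realType} {I : finType}.
Implicit Types (w : I -> I -> R) (x y : I) (s : seq I).

Fixpoint walk_weight w x s : R :=
  if s is y :: s' then w x y + walk_weight w y s' else 0.

Lemma walk_weight_cat w x s t :
  walk_weight w x (s ++ t) =
  walk_weight w x s + walk_weight w (last x s) t.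
Proof. by elim: s x => [|y s IH] x /=; rewrite ?add0r// IH addrA. Qed.

Lemma walk_weight_rcons w x s y :
  walk_weight w x (rcons s y) = walk_weight w x s + w (last x s) y.
Proof. by rewrite -cats1 walk_weight_cat /= addr0. Qed.

Lemma walk_weight_fpath w (f : I -> I) x s : fpath f x s ->
  walk_weight w x s = \sum_(i <- belast x s) w i (f i).
Proof.
elim: s x => [|y s IH] x /=; first by rewrite big_nil.
by case/andP => /eqP <- /IH ->; rewrite big_cons.
Qed.

(** A simple cycle is an orbit of the permutation that fixes the other points, and
fixed points cost nothing because [w i i = 0].  A closed walk that visits a
vertex twice splits into two shorter closed walks. *)
Lemma closed_walk_ge0 w :
  (forall i, w i i = 0) ->
  (forall t : {perm I}, 0 <= \sum_i w i (t i)) ->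
  forall x s, 0 <= walk_weight w x (rcons s x).
Proof.
move=> w0 wperm x s; have [n] := ubnP (size s).
elim: n x s => // n IH x s; rewrite ltnS => sn.
have [Us|] := boolP (uniq (x :: s)).
  have injn : injective (next (x :: s)) by exact: can_inj (prev_next Us).
  have := wperm (perm injn).
  rewrite (bigID (mem (x :: s))) /= [X in _ + X]big1 ?addr0; last first.
    move=> i ixs; rewrite permE next_nth.
    by rewrite (negbTE ixs) w0.
  rewrite -big_uniq//= (walk_weight_fpath _ (cycle_next Us)) belast_rcons.
  by under eq_bigr do rewrite permE.
rewrite cons_uniq negb_and negbK => /orP[|].
  move=> /splitPr xs; case: xs sn => s1 s2.
  rewrite size_cat /= => sn.
  rewrite -cat_rcons rcons_cat walk_weight_cat last_rcons addr_ge0//.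
    by apply: IH; lia.
  by apply: IH; lia.
move=> /(uniqPn x)[i [j [ij js sij]]].
have si : (i < size s)%N by exact: ltn_trans js.
set y := nth x s i.
(* [x :: s] passes twice through [y]: the loop [y :: s2] is cut out. *)
have [s1 [s2 [s3 es]]] : exists s1 s2 s3, s = s1 ++ y :: s2 ++ y :: s3.
  exists (take i s), (take (j - i.+1) (drop i.+1 s)), (drop j.+1 s).
  rewrite {1}/y sij -{1}(cat_take_drop i s); congr (_ ++ _).
  rewrite (drop_nth x)// sij; congr (_ :: _).
  rewrite -{1}(cat_take_drop (j - i.+1) (drop i.+1 s)); congr (_ ++ _).
  by rewrite drop_drop subnK// (drop_nth x js) /y sij.
move: sn; rewrite {}es; move: y => y {i j ij js sij si}.
rewrite !size_cat /= size_cat /= => sn.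
rewrite rcons_cat /= rcons_cat /= walk_weight_cat /= -cat_rcons walk_weight_cat.
rewrite last_rcons.
have := IH y s2; have := IH x (s1 ++ y :: s3).
rewrite rcons_cat walk_weight_cat /= size_cat /= => H1 H2.
by have := H1 ltac:(lia); have := H2 ltac:(lia); lra.
Qed.

(** The potential of [j] is the infimum of the weights of the walks from a base
point to [j].  It is finite because closing such a walk by the edge back to the
base point gives a closed walk, which has nonnegative weight. *)
Lemma exists_potential w :
  (forall i, w i i = 0) ->
  (forall t : {perm I}, 0 <= \sum_i w i (t i)) ->
  exists phi : I -> R, forall i j, phi j <= phi i + w i j.
Proof.
move=> w0 wperm.
have [i0 _|I0] := pickP I; last by exists (fun=> 0) => i; have := I0 i.
pose W j := [set walk_weight w i0 (rcons s j) | s in [set: seq I]].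
have WI j : has_inf (W j).
  split; first by exists (w i0 j + 0), [::].
  exists (- w j i0) => _ [s _ <-].
  rewrite lerNl -subr_ge0 opprK addrC.
  have := closed_walk_ge0 w0 wperm i0 (rcons s j).
  by rewrite walk_weight_rcons last_rcons.
exists (fun j => inf (W j)) => i j.
rewrite -lerBlDr; apply: lb_le_inf; first by case: (WI i).
move=> _ [s _ <-]; rewrite lerBlDr; apply: ge_inf; first by case: (WI j).
by exists (rcons s i) => //; rewrite walk_weight_rcons last_rcons.
Qed.

End NoNegativeCycle.

Lemma exists_optimal_perm (R : realType) (n : nat) (c : 'I_n -> 'I_n -> R) :
  exists s : {perm 'I_n}, forall t : {perm 'I_n},
    \sum_i c i (s i) <= \sum_i c i (t i).
Proof.
pose F (s : {perm 'I_n}) := \sum_i c i (s i).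
have := @Order.TotalTheory.arg_minP _ R _ (1%g : {perm 'I_n}) xpredT F isT.
case=> s _ sP; exists s => t; exact: sP.
Qed.

(** Kantorovich duality for two families of [n] points.  After relabelling by an
optimal [s], the reduced costs [d(x_i, y_j) - d(x_i, y_i)] have nonnegative sum
along every permutation, hence admit a potential [phi], and the lower envelope
of the functions [d(x_i, .) - d(x_i, y_i) + phi_i] is 1-Lipschitz and takes
the value [phi_i] at [y_i]. *)
Lemma assignment_duality (R : realType) (M : Type) (dist : M -> M -> R)
    (n : nat) (x y : 'I_n -> M) :
  (forall a, dist a a = 0) ->
  (forall a b, dist a b = dist b a) ->
  (forall a b c, dist a c <= dist a b + dist b c) ->
  exists (s : {perm 'I_n}) (f : M -> R),
    (forall a b, f a - f b <= dist a b) /\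
    (forall i, dist (x i) (y (s i)) <= f (y (s i)) - f (x i)).
Proof.
move=> d0 dC dT.
have [s sP] := exists_optimal_perm (fun i j => dist (x i) (y j)).
exists s.
pose w i j := dist (x i) (y (s j)) - dist (x i) (y (s i)).
have [||phi phiP] := @exists_potential R _ w.
- by move=> i; rewrite /w subrr.
- move=> t; rewrite /w sumrB subr_ge0.
  have := sP (t * s)%g.
  by under [X in _ <= X -> _]eq_bigr do rewrite permM.
case: n => [|n] in x y s sP w phi phiP *.
  exists (fun=> 0); split=> [a b|[]//]; rewrite subrr.
  by have := dT a b a; rewrite d0 (dC b a); lra.
pose g i a := dist (x i) a - dist (x i) (y (s i)) + phi i.
pose f a := g [arg min_(i < ord0) (g i a)]%O a.
have fle i a : f a <= g i a.
  by rewrite /f; case: Order.TotalTheory.arg_minP => // j _; exact.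
exists f; split.
  move=> a b; rewrite lerBlDr {2}/f.
  set i := Order.arg_min _ _ _.
  apply: le_trans (fle i a) _; rewrite /g.
  by have := dT (x i) b a; rewrite (dC b a); lra.
move=> i.
have := fle i (x i); rewrite /g d0.
have : phi i <= f (y (s i)).
  rewrite /f /g; set j := Order.arg_min _ _ _.
  by have := phiP j i; rewrite /w; lra.
lra.
Qed.

(** * W1 of two empirical measures and the cost of a matching *)

Section EuclideanDistance.
Context {R : realType} {d : nat}.
Implicit Types x y z : d.-tuple R.

Lemma edist_ge0 x y : 0 <= edist x y.
Proof. exact: sqrtr_ge0. Qed.

Lemma edistxx x : edist x x = 0.
Proof. by rewrite /edist big1 ?sqrtr0// => i _; rewrite subrr expr0n. Qed.

Lemma edistC x y : edist x y = edist y x.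
Proof. by congr Num.sqrt; apply: eq_bigr => i _; rewrite -opprB sqrrN. Qed.

Lemma cauchy_schwarz_sum (I : finType) (a b : I -> R) :
  \sum_i a i * b i <=
  Num.sqrt (\sum_i a i ^+ 2) * Num.sqrt (\sum_i b i ^+ 2).
Proof.
set A := \sum_i a i ^+ 2; set B := \sum_i b i ^+ 2.
have A0 : 0 <= A by apply: sumr_ge0 => i _; exact: sqr_ge0.
have B0 : 0 <= B by apply: sumr_ge0 => i _; exact: sqr_ge0.
have sA0 := sqrtr_ge0 A; have sB0 := sqrtr_ge0 B.
have sq_eq0 (c : I -> R) : \sum_i c i ^+ 2 = 0 -> forall i, c i = 0.
  move=> /eqP; rewrite psumr_eq0 => [/allP c0 i|i _]; last exact: sqr_ge0.
  by have /implyP/(_ isT) := c0 i (mem_index_enum i); rewrite sqrf_eq0 => /eqP.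
have [/sq_eq0 a0|An0] := eqVneq A 0.
  by rewrite big1 ?mulr_ge0// => i _; rewrite a0 mul0r.
have [/sq_eq0 b0|Bn0] := eqVneq B 0.
  by rewrite big1 ?mulr_ge0// => i _; rewrite b0 mulr0.
have sA : 0 < Num.sqrt A by rewrite sqrtr_gt0 lt_def An0.
have sB : 0 < Num.sqrt B by rewrite sqrtr_gt0 lt_def Bn0.
set p := Num.sqrt A in sA *; set q := Num.sqrt B in sB *.
have pA : p ^+ 2 = A by rewrite sqr_sqrtr.
have qB : q ^+ 2 = B by rewrite sqr_sqrtr.
have : 0 <= \sum_i (q * a i - p * b i) ^+ 2.
  by apply: sumr_ge0 => i _; exact: sqr_ge0.
under eq_bigr => i _.
  rewrite (_ : _ ^+ 2 = q ^+ 2 * a i ^+ 2 + p ^+ 2 * b i ^+ 2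
    - (2 * p * q) * (a i * b i)); last by ring.
  over.
rewrite sumrB big_split/= -!mulr_sumr -/A -/B -pA -qB.
rewrite (_ : _ - _ = (2 * (p * q)) * (p * q - \sum_i a i * b i)); last by ring.
by rewrite pmulr_rge0 ?subr_ge0// mulr_gt0// mulr_gt0.
Qed.

Lemma edist_triangle x y z : edist x z <= edist x y + edist y z.
Proof.
rewrite -(@ler_pXn2r _ 2)// ?nnegrE ?addr_ge0 ?edist_ge0//.
have sq0 u v : 0 <= \sum_(i < d) (tnth u i - tnth v i : R) ^+ 2.
  by apply: sumr_ge0 => i _; exact: sqr_ge0.
rewrite sqrrD !sqr_sqrtr//.
have := cauchy_schwarz_sum (fun i => tnth x i - tnth y i) (fun i => tnth y i - tnth z i).
rewrite -/(edist x y) -/(edist y z) => cs.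
apply: (@le_trans _ _ (\sum_(i < d) (tnth x i - tnth y i) ^+ 2 +
  2 * (\sum_(i < d) (tnth x i - tnth y i) * (tnth y i - tnth z i)) +
  \sum_(i < d) (tnth y i - tnth z i) ^+ 2)); last by rewrite mulr2n; lra.
rewrite mulr_sumr -!big_split/= le_eqVlt; apply/orP; left; apply/eqP.
by apply: eq_bigr => i _; ring.
Qed.

Lemma edist_le_sum x y : edist x y <= \sum_(i < d) `|tnth x i - tnth y i|.
Proof.
have s0 : 0 <= \sum_(i < d) `|tnth x i - tnth y i| by exact: sumr_ge0.
rewrite -(@ler_pXn2r _ 2)// ?nnegrE ?edist_ge0// sqr_sqrtr; last first.
  by apply: sumr_ge0 => i _; exact: sqr_ge0.
rewrite expr2 mulr_suml; apply: ler_sum => i _.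
rewrite -real_normK ?num_real// expr2 ler_wpM2l//.
by rewrite (bigD1 i)//= lerDl sumr_ge0.
Qed.

Lemma measurable_edist : measurable_fun [set: d.-tuple R * d.-tuple R]
  (fun z : (d.-tuple R * d.-tuple R)%type => (edist z.1 z.2)%:E).
Proof.
apply/measurable_EFinP.
pose g (z : d.-tuple R * d.-tuple R) : R :=
  \sum_(i < d) (tnth z.1 i - tnth z.2 i) ^+ 2.
have msqrt : measurable_fun [set: R] (Num.sqrt : R -> R).
  by apply: continuous_measurable_fun; exact: sqrt_continuous.
rewrite -[X in measurable_fun _ X]/(Num.sqrt \o g).
apply: measurableT_comp msqrt _.
apply: measurable_sum => i; apply: measurable_funX; apply: measurable_funB.
  by apply: measurableT_comp (measurable_tnth i) _; exact: measurable_fst.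
by apply: measurableT_comp (measurable_tnth i) _; exact: measurable_snd.
Qed.

End EuclideanDistance.

Section PermutationCoupling.
Context {R : realType} {d : nat}.
Implicit Types x y : nat -> d.-tuple R.

(** Extended by the identity, since [msum] sums a sequence of measures indexed by
[nat]. *)
Definition perm_nat n (s : {perm 'I_n}) (k : nat) : nat :=
  if insub k is Some i then s i else k.

Lemma perm_natE n (s : {perm 'I_n}) (i : 'I_n) : perm_nat s i = s i.
Proof. by rewrite /perm_nat valK. Qed.

Definition perm_coupling x y n (s : {perm 'I_n}) :
    {measure set (d.-tuple R * d.-tuple R)%type -> \bar R} :=
  mscale ((n%:R : R)^-1)%:nng
    (msum (fun k => dirac (x k, y (perm_nat s k)) :
      {measure set (d.-tuple R * d.-tuple R)%type -> \bar R}) n).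

Lemma empiricalE x n A :
  empirical x n A = ((n%:R^-1)%:E * \sum_(i < n) \d_(x i) A)%E.
Proof. by []. Qed.

Lemma perm_couplingE x y n s A : perm_coupling x y s A =
  ((n%:R^-1)%:E * \sum_(i < n) \d_(x i, y (s i)) A)%E.
Proof.
rewrite /perm_coupling /= /mscale /= /msum /=; congr (_ * _)%E.
by apply: eq_bigr => i _; rewrite perm_natE.
Qed.

Lemma perm_coupling_setT x y n (s : {perm 'I_n}) : (0 < n)%N ->
  perm_coupling x y s setT = 1%E.
Proof.
move=> n0; rewrite perm_couplingE.
under eq_bigr do rewrite diracT.
rewrite sumEFin sumr_const card_ord -EFinM mulVf//.
by rewrite pnatr_eq0 -lt0n.
Qed.

Lemma W1_empirical_le x y n (s : {perm 'I_n}) : (0 < n)%N ->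
  (W1 (empirical x n) (empirical y n) <=
   (n%:R^-1 * \sum_(i < n) edist (x i) (y (s i)))%:E)%E.
Proof.
move=> n0.
pose p := perm_coupling x y s.
pose Q : probability _ R := HB.pack (Measure.sort p) (Measure.class p)
  (Measure_isProbability.Build _ _ _ p (perm_coupling_setT x y s n0)).
apply: ereal_inf_lbound; exists Q.
  split=> A mA.
    rewrite [LHS](perm_couplingE x y s) empiricalE; congr (_ * _)%E.
  rewrite [LHS](perm_couplingE x y s) empiricalE; congr (_ * _)%E.
  rewrite [RHS](reindex_inj (@perm_inj _ s))/=.
  by apply: eq_bigr => i _; rewrite !diracE.
rewrite ge0_integral_mscale//=; last 2 first.
- exact: measurable_edist.
- by move=> z _; rewrite lee_fin edist_ge0.
rewrite ge0_integral_measure_sum//; last 2 first.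
- by move=> z _; rewrite lee_fin edist_ge0.
- exact: measurable_edist.
rewrite EFinM; congr (_ * _)%E; rewrite -sumEFin; apply: eq_bigr => i _.
rewrite integral_dirac//; last exact: measurable_edist.
by rewrite diracT mul1e perm_natE.
Qed.

End PermutationCoupling.

Section IntegralBound.
Context {disp : measure_display} {T : measurableType disp} {R : realType}.
Variable mu : {measure set T -> \bar R}.

(** [W1] of two random empirical measures is an infimum over uncountably many
couplings, of which no measurability is established.  The integral of a
nonnegative function being defined as a supremum over the simple functions
below it, monotonicity needs none. *)
Lemma le_integral_nonmeasurable (f g : T -> \bar R) :
  (forall w, 0 <= f w)%E -> (forall w, f w <= g w)%E ->
  (\int[mu]_w f w <= \int[mu]_w g w)%E.
Proof.
move=> f0 fg; have g0 w : (0 <= g w)%E by exact: le_trans (fg w).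
rewrite !ge0_integralTE//; apply: le_ereal_sup => _ [h hf <-].
by exists h => // w; exact: le_trans (fg w).
Qed.

End IntegralBound.

Lemma W1_ge0 (R : realType) (d : nat)
  (m1 m2 : {measure set (d.-tuple R) -> \bar R}) : (0 <= W1 m1 m2)%E.
Proof.
apply: le_ereal_inf_tmp => _ [l _ <-].
by apply: integral_ge0 => z _; rewrite lee_fin edist_ge0.
Qed.

(** * Trigonometric sums *)

Section TrigSums.
Context {R : realType}.
Implicit Types (t : R) (k l m p x : nat).

Lemma sin_shift_pi p t : sin (t + pi * p%:R) = (-1) ^+ p * sin t :> R.
Proof.
elim: p => [|p IH]; first by rewrite mulr0 addr0 expr0 mul1r.
by rewrite -[p.+1%:R]natr1 mulrDr mulr1 addrA sinDpi IH exprS mulN1r mulNr.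
Qed.

(** Multiplying by [2 sin (t / 2)] makes the sum telescope. *)
Lemma sum_cos_arith t c m :
  2 * sin (t / 2) * (\sum_(0 <= x < m) cos (t * (x%:R + c))) =
  sin (t * (m%:R + c - 2^-1)) - sin (t * (c - 2^-1)).
Proof.
rewrite mulr_sumr (telescope_sumr_eq (fun x => sin (t * (x%:R + c - 2^-1)))) ?add0r//.
move=> x _; rewrite -[x.+1%:R]natr1.
rewrite (_ : t * (x%:R + 1 + c - 2^-1) = t * (x%:R + c) + t / 2); last by field.
rewrite (_ : t * (x%:R + c - 2^-1) = t * (x%:R + c) - t / 2); last by field.
by rewrite sinD sinB; ring.
Qed.

(** The frequencies of the discrete cosine transform of length [m]. *)
Definition freq m k : R := pi * k%:R / m%:R.

Lemma freq_half m k : freq m k / 2 = pi * k%:R / (2 * m%:R) :> R.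
Proof. by rewrite /freq invfM; ring. Qed.

Lemma sin_freq_half_gt0 m p : (0 < p < 2 * m)%N -> 0 < sin (freq m p / 2).
Proof.
move=> /andP[p0 pm]; apply: sin_gt0_pi; have pi0 := pi_gt0 R.
have m0 : (0 < m)%N by lia.
have mR : 0 < 2 * m%:R :> R by rewrite mulr_gt0 ?ltr0n.
rewrite freq_half; apply/andP; split.
  by rewrite divr_gt0// mulr_gt0// ltr0n.
by rewrite ltr_pdivrMr// ltr_pM2l// -natrM ltr_nat.
Qed.

(** At the frequency [pi p / m] the last argument of the telescoped sum is that of
the first one shifted by [pi p].  The phase [c = 1/2] serves the cosines, whose
nodes are the midpoints [x + 1/2], and [c = 1] serves their differences. *)
Lemma sum_cos_freq m p c : (0 < p < 2 * m)%N ->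
  \sum_(0 <= x < m) cos (freq m p * (x%:R + c)) =
  ((-1) ^+ p - 1) * sin (freq m p * (c - 2^-1)) / (2 * sin (freq m p / 2)).
Proof.
move=> pm; have s0 := sin_freq_half_gt0 pm.
have m0 : m%:R != 0 :> R by rewrite pnatr_eq0; lia.
have ns0 : 2 * sin (freq m p / 2) != 0 by rewrite mulf_neq0// gt_eqF.
apply: (mulfI ns0); rewrite sum_cos_arith [RHS]mulrC divfK//.
rewrite (_ : freq m p * (m%:R + c - 2^-1) = freq m p * (c - 2^-1) + pi * p%:R).
  by rewrite sin_shift_pi; ring.
by rewrite /freq; field.
Qed.

Lemma sum_cos_half m p : (0 < p < 2 * m)%N ->
  \sum_(0 <= x < m) cos (freq m p * (x%:R + 2^-1)) = 0.
Proof. by move=> pm; rewrite sum_cos_freq// subrr mulr0 sin0 mulr0 mul0r. Qed.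

Lemma sum_cos_one m p : (0 < p < 2 * m)%N ->
  \sum_(0 <= x < m) cos (freq m p * (x%:R + 1)) = ((-1) ^+ p - 1) / 2.
Proof.
move=> pm; rewrite sum_cos_freq//.
have s0 := sin_freq_half_gt0 pm.
rewrite (_ : 1 - 2^-1 = 2^-1 :> R); last by field.
by field; rewrite gt_eqF.
Qed.

Lemma freqD m k l : freq m (k + l) = freq m k + freq m l.
Proof. by rewrite /freq natrD; ring. Qed.

Lemma freqB m k l : (l <= k)%N -> freq m (k - l) = freq m k - freq m l.
Proof. by move=> lk; rewrite /freq natrB//; ring. Qed.

Lemma sum_cosM m k l : (l < k < m)%N ->
  \sum_(0 <= x < m)
    cos (freq m k * (x%:R + 2^-1)) * cos (freq m l * (x%:R + 2^-1)) = 0.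
Proof.
move=> /andP[lk km].
have H (x : nat) : cos (freq m k * (x%:R + 2^-1)) * cos (freq m l * (x%:R + 2^-1)) =
  (cos (freq m (k - l) * (x%:R + 2^-1)) + cos (freq m (k + l) * (x%:R + 2^-1))) / 2.
  by rewrite freqB ?(ltnW lk)// freqD [(_ - freq m l) * _]mulrBl
    [(_ + freq m l) * _]mulrDl cosB cosD; field.
under eq_bigr do rewrite H.
by rewrite -mulr_suml big_split/= !sum_cos_half ?addr0 ?mul0r//; lia.
Qed.

Lemma sum_cos_sq m k : (0 < k < m)%N ->
  \sum_(0 <= x < m) cos (freq m k * (x%:R + 2^-1)) ^+ 2 = m%:R / 2.
Proof.
move=> /andP[k0 km].
have H (x : nat) : cos (freq m k * (x%:R + 2^-1)) ^+ 2 =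
  (1 + cos (freq m (k + k) * (x%:R + 2^-1))) / 2.
  by rewrite freqD [(_ + freq m k) * _]mulrDl cosD -!expr2 sin2cos2; field.
under eq_bigr do rewrite H.
rewrite -mulr_suml big_split/= sum_cos_half; last lia.
by rewrite addr0 sumr_const_nat subn0.
Qed.

(** The two sums of cosines need not vanish here, but they are equal because
[k - l] and [k + l] have the same parity. *)
Lemma sum_sinM m k l : (0 < l)%N -> (l < k < m)%N ->
  \sum_(0 <= x < m)
    sin (freq m k * (x%:R + 1)) * sin (freq m l * (x%:R + 1)) = 0.
Proof.
move=> l0 /andP[lk km].
have H (x : nat) : sin (freq m k * (x%:R + 1)) * sin (freq m l * (x%:R + 1)) =
  (cos (freq m (k - l) * (x%:R + 1)) - cos (freq m (k + l) * (x%:R + 1))) / 2.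
  by rewrite freqB ?(ltnW lk)// freqD [(_ - freq m l) * _]mulrBl
    [(_ + freq m l) * _]mulrDl cosB cosD; field.
under eq_bigr do rewrite H.
rewrite -mulr_suml sumrB/= !sum_cos_one; [|lia|lia].
rewrite -(signr_odd _ (k - l)) -(signr_odd _ (k + l)) oddB ?(ltnW lk)// oddD.
by rewrite subrr mul0r.
Qed.

Lemma sum_sin_sq m k : (0 < k < m)%N ->
  \sum_(0 <= x < m) sin (freq m k * (x%:R + 1)) ^+ 2 = m%:R / 2.
Proof.
move=> /andP[k0 km].
have H (x : nat) : sin (freq m k * (x%:R + 1)) ^+ 2 =
  (1 - cos (freq m (k + k) * (x%:R + 1))) / 2.
  by rewrite freqD [(_ + freq m k) * _]mulrDl cosD -!expr2 cos2sin2; field.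
under eq_bigr do rewrite H.
rewrite -mulr_suml sumrB/= sum_cos_one; last lia.
rewrite -(signr_odd _ (k + k)) oddD addbb expr0 subrr mul0r subr0.
by rewrite sumr_const_nat subn0.
Qed.

(** The mean value theorem on [[0, t/2]] gives [sin (t/2) >= (t/2) cos (t/2)], hence
[sin t >= t cos (t/2)^2 = t (1 + cos t) / 2]. *)
Lemma sin_ge_half t : 0 <= t -> t <= pi / 2 -> t / 2 <= sin t.
Proof.
rewrite le_eqVlt => /predU1P[<- _|t0 tpi]; first by rewrite sin0 mul0r.
have pi0 := pi_gt0 R.
have [||c] := @MVT R sin cos 0 (t / 2).
- by rewrite divr_gt0.
- by apply: continuous_subspaceT => x; exact: continuous_sin.
rewrite in_itv/= => /andP[c0 ct]; rewrite sin0 !subr0 => st.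
have cc : cos (t / 2) <= cos c.
  apply: ltW; rewrite ltr_cos ?in_itv/=//; first by lra.
  by apply/andP; split; lra.
have ct0 : 0 <= cos t by apply: cos_ge0_pihalf; apply/andP; split; lra.
have ch0 : 0 <= cos (t / 2) by apply: cos_ge0_pihalf; apply/andP; split; lra.
have e1 : sin t = 2 * sin (t / 2) * cos (t / 2).
  by rewrite {1}(_ : t = t / 2 + t / 2) ?sinD; [ring|field].
have e2 : cos t = 2 * cos (t / 2) ^+ 2 - 1.
  by rewrite {1}(_ : t = t / 2 + t / 2) ?cosD -?expr2 ?sin2cos2; [ring|field].
have {}e1 : sin t = t * (cos c * cos (t / 2)) by rewrite e1 st; field.
rewrite e1 ler_pM2l//; move: (cos c) (cos (t / 2)) (cos t) cc ch0 ct0 e2 => u v z.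
nra.
Qed.

End TrigSums.

(** * The discrete cosine basis of an interval *)

Section CosineBasis.
Context {R : realType}.
Variable m : nat.
Local Notation M := m.+1.
Implicit Types (k l x y : 'I_M).

Definition cos_amp (k : nat) : R :=
  if k == 0%N then (Num.sqrt M%:R)^-1 else Num.sqrt (2 / M%:R).

(** The orthonormal basis of the type-II discrete cosine transform, that is, the
eigenvectors of the Neumann Laplacian of a path with [M] vertices. *)
Definition cos_basis (k x : nat) : R :=
  cos_amp k * cos (freq M k * (x%:R + 2^-1)).

Definition cos_eigen (k : nat) : R := 4 * sin (freq M k / 2) ^+ 2.

(** The last vertex is its own successor, so that the difference operator below
obeys the Neumann boundary condition. *)
Definition ord_next x : 'I_M := inord (minn x.+1 m).

Definition cos_diff (k : nat) x : R := cos_basis k (ord_next x) - cos_basis k x.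

Let M0 : 0 < M%:R :> R. Proof. by rewrite ltr0n. Qed.

Lemma cos_amp_sq k : cos_amp k ^+ 2 = (if k == 0%N :> nat then 1 else 2) / M%:R.
Proof.
rewrite /cos_amp; case: ifP => _.
  by rewrite exprVn sqr_sqrtr ?ltW// div1r.
by rewrite sqr_sqrtr// divr_ge0// ltW.
Qed.

Lemma cos_amp_sq_le k : cos_amp k ^+ 2 <= 2 / M%:R.
Proof. by rewrite cos_amp_sq ler_pM2r ?invr_gt0//; case: ifP => _; lra. Qed.

Lemma cos_basis_sq_le k (x : nat) : cos_basis k x ^+ 2 <= 2 / M%:R.
Proof.
rewrite /cos_basis exprMn; apply: le_trans (cos_amp_sq_le k).
by rewrite ler_piMr ?sqr_ge0// -sin2cos2Df lerDr sqr_ge0.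
Qed.

Lemma cos_basis_gram k l :
  \sum_(x < M) cos_basis k x * cos_basis l x = (k == l)%:R.
Proof.
rewrite -(big_mkord xpredT (fun x : nat => cos_basis k x * cos_basis l x)).
rewrite /cos_basis; under eq_bigr do rewrite mulrACA.
rewrite -mulr_sumr; case: eqVneq => [<-|kl].
  under eq_bigr do rewrite -expr2.
  rewrite -expr2 cos_amp_sq; have [k0|k0] := eqVneq (k : nat) 0%N.
    rewrite k0; under eq_bigr do rewrite /freq mulr0 !mul0r cos0 expr1n.
    by rewrite sumr_const_nat subn0 div1r mulVf// gt_eqF.
  rewrite sum_cos_sq; last by rewrite lt0n k0 ltn_ord.
  by rewrite mulr1n; field; rewrite gt_eqF.
suff -> : \sum_(0 <= x < M) cos (freq M k * (x%:R + 2^-1)) *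
   cos (freq M l * (x%:R + 2^-1)) = 0 :> R by rewrite mulr0.
have := kl; rewrite -val_eqE neq_ltn/= => /orP[lk|lk].
  by under eq_bigr do rewrite mulrC; rewrite sum_cosM// lk ltn_ord.
by rewrite sum_cosM// lk ltn_ord.
Qed.

(** A square matrix with orthonormal rows has orthonormal columns. *)
Lemma cos_basis_complete x y :
  \sum_(k < M) cos_basis k x * cos_basis k y = (x == y)%:R.
Proof.
pose U : 'M[R]_M := \matrix_(k, x) cos_basis k x.
have : U *m U^T = 1%:M.
  apply/matrixP => k l; rewrite !mxE -cos_basis_gram.
  by apply: eq_bigr => z _; rewrite !mxE.
move=> /mulmx1C /matrixP /(_ x y); rewrite !mxE => <-.
by apply: eq_bigr => z _; rewrite !mxE.
Qed.

(** The difference of two cosines is a sine, which vanishes at the last vertex as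
the Neumann condition requires. *)
Lemma cos_diffE k x :
  cos_diff k x = - (2 * cos_amp k * sin (freq M k / 2)) *
                 sin (freq M k * (x%:R + 1)).
Proof.
have step (y : nat) : cos_basis k y.+1 - cos_basis k y =
    - (2 * cos_amp k * sin (freq M k / 2)) * sin (freq M k * (y%:R + 1)).
  rewrite /cos_basis -[y.+1%:R]natr1.
  rewrite (_ : freq M k * (y%:R + 1 + 2^-1) =
    freq M k * (y%:R + 1) + freq M k / 2); last by field.
  rewrite (_ : freq M k * (y%:R + 2^-1) =
    freq M k * (y%:R + 1) - freq M k / 2); last by field.
  by rewrite cosD cosB; ring.
rewrite /cos_diff inordK; last by rewrite ltnS geq_minr.
have [xm|xm] := ltnP x m; first by rewrite (minn_idPl xm) step.
have {xm}xm : x = m :> nat by apply/eqP; rewrite eqn_leq xm -ltnS ltn_ord.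
rewrite xm (minn_idPr (leqnSn _)) subrr natr1 /freq divfK ?gt_eqF//.
by rewrite -[pi * _]add0r sin_shift_pi sin0 !mulr0.
Qed.

Lemma cos_diff_gram k l :
  \sum_(x < M) cos_diff k x * cos_diff l x = (k == l)%:R * cos_eigen k.
Proof.
under eq_bigr do rewrite !cos_diffE mulrACA.
rewrite -mulr_sumr.
rewrite -(big_mkord xpredT (fun x : nat =>
  sin (freq M k * (x%:R + 1)) * sin (freq M l * (x%:R + 1)))).
have [k0|k0] := eqVneq (k : nat) 0%N.
  by rewrite /cos_eigen k0 /freq mulr0 !mul0r sin0 !mulr0 !(oppr0,mul0r,expr0n,mulr0).
have [l0|l0] := eqVneq (l : nat) 0%N.
  rewrite (negbTE (_ : k != l)); last by apply: contra_neq k0 => ->.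
  by rewrite mul0r /freq l0 mulr0 !mul0r sin0 !mulr0 !(oppr0,mul0r,expr0n,mulr0).
case: eqVneq => [<-|kl].
  under eq_bigr do rewrite -expr2.
  rewrite sum_sin_sq; last by rewrite lt0n k0 ltn_ord.
  rewrite -expr2 sqrrN !exprMn cos_amp_sq (negbTE k0) /cos_eigen.
  by rewrite mulr1n; field; rewrite gt_eqF.
rewrite mul0r.
suff -> : \sum_(0 <= x < M) sin (freq M k * (x%:R + 1)) *
   sin (freq M l * (x%:R + 1)) = 0 :> R by rewrite mulr0.
have := kl; rewrite -val_eqE neq_ltn/= => /orP[lk|lk].
  by under eq_bigr do rewrite mulrC; rewrite sum_sinM ?lt0n// lk ltn_ord.
by rewrite sum_sinM ?lt0n// lk ltn_ord.
Qed.

Lemma cos_eigen_ge0 k : 0 <= cos_eigen k.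
Proof. by rewrite mulr_ge0// sqr_ge0. Qed.

Lemma cos_eigen_ge k : (k%:R / M%:R) ^+ 2 <= cos_eigen k.
Proof.
have pi2 := pi_ge2 R; have pi0 := pi_gt0 R.
have kM : 0 <= k%:R / M%:R :> R by rewrite divr_ge0// ltW.
have kM1 : k%:R / M%:R <= 1 :> R.
  by rewrite ler_pdivrMr// mul1r ler_nat ltnW.
have f0 : 0 <= freq M k / 2 :> R.
  by rewrite divr_ge0// /freq -mulrA mulr_ge0// ltW.
have fpi : freq M k / 2 <= pi / 2 :> R.
  by rewrite ler_pM2r ?invr_gt0// /freq -mulrA ger_pMr.
have := sin_ge_half f0 fpi.
have af : 2 * (k%:R / M%:R) <= freq M k :> R by rewrite /freq -[leRHS]mulrA ler_wpM2r.
move=> sf; have {}sf : k%:R / M%:R <= 2 * sin (freq M k / 2) :> R.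
  by move: (_ / _) (freq _ _) (sin _) af sf => a f s af sf; lra.
rewrite /cos_eigen (_ : 4 * _ = (2 * sin (freq M k / 2)) ^+ 2); last by ring.
by rewrite ler_pXn2r// ?nnegrE// (le_trans kM).
Qed.

End CosineBasis.

(** * Fourier analysis on the grid *)

Section GridFourier.
Context {R : realType}.
Variables d m : nat.
Local Notation M := m.+1.
Local Notation grid := {ffun 'I_d -> 'I_M}.
Implicit Types (k l x y : grid) (i : 'I_d) (f D : grid -> R).

Definition grid_cos k x : R := \prod_i cos_basis m (k i) (x i).

Definition grid_step i x : grid :=
  [ffun j => if j == i then ord_next (x j) else x j].

Definition grid_eigen k : R := \sum_i cos_eigen m (k i).

Definition grid_coef f k : R := \sum_x f x * grid_cos k x.

Definition grid0 : grid := [ffun=> ord0].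

Lemma prod_eq_ffun k l : \prod_i (k i == l i)%:R = (k == l)%:R :> R.
Proof.
have [->|kl] := eqVneq; first by rewrite big1// => i _; rewrite eqxx.
have [i ki] : exists i, k i != l i.
  apply/existsP; rewrite -negb_forall; apply: contra kl => /forallP H.
  by apply/eqP/ffunP => i; apply/eqP.
by rewrite (bigD1 i)//= (negbTE ki) mul0r.
Qed.

Lemma grid_cos_complete x y :
  \sum_k grid_cos k x * grid_cos k y = (x == y)%:R.
Proof.
under eq_bigr do rewrite /grid_cos -big_split/=.
rewrite -(bigA_distr_bigA (fun i (z : 'I_M) => cos_basis m z (x i) * cos_basis m z (y i))).
by rewrite -prod_eq_ffun; apply: eq_bigr => i _; rewrite cos_basis_complete.
Qed.

Lemma grid_cos_diffE i k x : grid_cos k (grid_step i x) - grid_cos k x =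
  \prod_j (if j == i then cos_diff (k j) (x j) else cos_basis m (k j) (x j)).
Proof.
rewrite /grid_cos !(bigD1 (P := xpredT) i)//= eqxx ffunE eqxx.
rewrite [X in _ * X - _](eq_bigr (fun j => cos_basis m (k j) (x j))); last first.
  by move=> j /negbTE ji; rewrite ffunE ji.
rewrite [X in _ = _ * X](eq_bigr (fun j => cos_basis m (k j) (x j))); last first.
  by move=> j /negbTE ji; rewrite ji.
by rewrite -mulrBl.
Qed.

(** A difference in the direction [i] only affects the [i]-th factor of a product of
cosines, so that orthogonality is inherited from dimension 1. *)
Lemma grid_cos_diff_gram i k l :
  \sum_x (grid_cos k (grid_step i x) - grid_cos k x) *
         (grid_cos l (grid_step i x) - grid_cos l x) =
  (k == l)%:R * cos_eigen m (k i).
Proof.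
under eq_bigr do rewrite !grid_cos_diffE -big_split/=.
rewrite -(bigA_distr_bigA (fun j (z : 'I_M) =>
  (if j == i then cos_diff (k j) z else cos_basis m (k j) z) *
  (if j == i then cos_diff (l j) z else cos_basis m (l j) z))).
rewrite -prod_eq_ffun !(bigD1 (P := xpredT) i)//= eqxx cos_diff_gram mulrAC.
congr (_ * _ * _); apply: eq_bigr => j /negbTE ji.
by rewrite ji cos_basis_gram.
Qed.

Lemma grid_inversion f x : f x = \sum_k grid_coef f k * grid_cos k x.
Proof.
under eq_bigr do rewrite /grid_coef mulr_suml.
rewrite exchange_big/=.
under eq_bigr => y _ do (under eq_bigr do rewrite -mulrA; rewrite -mulr_sumr grid_cos_complete).
rewrite (bigD1 x)//= eqxx mulr1 big1 ?addr0// => y /negbTE ->.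
by rewrite mulr0.
Qed.

Lemma sum_sq_orthogonal (K X : finType) (c : K -> R) (w : K -> X -> R) (g : K -> R) :
  (forall k l : K, \sum_x w k x * w l x = (k == l)%:R * g k) ->
  \sum_x (\sum_(k : K) c k * w k x) ^+ 2 = \sum_k g k * c k ^+ 2.
Proof.
move=> orth; under eq_bigr do rewrite expr2 big_distrlr/=.
rewrite exchange_big/=; apply: eq_bigr => k _.
rewrite exchange_big/=.
under eq_bigr => l _.
  under eq_bigr do rewrite mulrACA.
  rewrite -mulr_sumr orth.
  over.
rewrite (bigD1 k)//= eqxx big1 ?addr0 => [|l]; first by rewrite mul1r; ring.
by rewrite eq_sym => /negbTE ->; rewrite mul0r mulr0.
Qed.

(** Parseval for the discrete gradient, by orthogonality of the gradients of the
basis functions. *)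
Lemma grid_gradient_energy f :
  \sum_k grid_eigen k * grid_coef f k ^+ 2 =
  \sum_i \sum_x (f (grid_step i x) - f x) ^+ 2.
Proof.
under eq_bigr do rewrite mulr_suml.
rewrite exchange_big/=; apply: eq_bigr => i _.
rewrite -(sum_sq_orthogonal _ (grid_cos_diff_gram i)).
apply: eq_bigr => x _; congr (_ ^+ 2).
rewrite (grid_inversion f x) (grid_inversion f (grid_step i x)) -sumrB.
by apply: eq_bigr => k _; rewrite mulrBr.
Qed.

Lemma grid_coef_pairing f D :
  \sum_x f x * D x = \sum_k grid_coef f k * grid_coef D k.
Proof.
under eq_bigr do rewrite (grid_inversion f) mulr_suml.
rewrite exchange_big/=; apply: eq_bigr => k _.
by rewrite /grid_coef [in RHS]mulr_sumr; apply: eq_bigr => x _; ring.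
Qed.

Lemma grid_coef0 D : \sum_x D x = 0 -> grid_coef D grid0 = 0.
Proof.
move=> D0; rewrite /grid_coef.
pose c : R := \prod_(i < d) cos_basis m 0 0.
rewrite (eq_bigr (fun x => D x * c)) => [|x _]; first by rewrite -mulr_suml D0 mul0r.
congr (_ * _); apply: eq_bigr => i _; rewrite ffunE.
by rewrite /cos_basis /freq !mulr0 !mul0r.
Qed.

Lemma grid_eigen_ge k : (\sum_i (k i)%:R ^+ 2) / M%:R ^+ 2 <= grid_eigen k.
Proof.
rewrite mulr_suml; apply: ler_sum => i _.
by rewrite -exprVn -exprMn cos_eigen_ge.
Qed.

Lemma grid_norm_gt0 k : k != grid0 -> 0 < \sum_i (k i)%:R ^+ 2 :> R.
Proof.
move=> k0; have [i ki] : exists i, k i != ord0.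
  apply/existsP; rewrite -negb_forall; apply: contra k0 => /forallP H.
  by apply/eqP/ffunP => i; rewrite ffunE; apply/eqP.
rewrite (bigD1 i)//= ltr_pwDl//; last by apply: sumr_ge0 => j _; exact: sqr_ge0.
by rewrite exprn_gt0// ltr0n lt0n.
Qed.

Lemma grid_eigen_gt0 k : k != grid0 -> 0 < grid_eigen k.
Proof.
by move=> /grid_norm_gt0 k0; rewrite (lt_le_trans _ (grid_eigen_ge k))// divr_gt0// exprn_gt0.
Qed.

Lemma grid_cos_sq_le k x : grid_cos k x ^+ 2 <= (2 / M%:R) ^+ d.
Proof.
rewrite /grid_cos -prodrXl -[d in leRHS]card_ord -prodr_const.
by apply: ler_prod => i _; rewrite sqr_ge0 cos_basis_sq_le.
Qed.

(** Parseval turns the pairing into a sum over frequencies, where the zero frequency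
does not contribute because [D] has total mass 0.  The parameter [t] balances
the Dirichlet energy of [f] against the negative Sobolev norm of [D]; optimizing
it would give the Cauchy-Schwarz bound, but a deterministic [t] leaves a
quantity that is linear in the squared coefficients of [D], whose expectation is
accessible. *)
Lemma grid_dual_bound f D t : 0 < t ->
  (forall i x, `|f (grid_step i x) - f x| <= M%:R^-1) ->
  \sum_x D x = 0 ->
  \sum_x f x * D x <=
  t / 2 * (d%:R * M%:R ^+ d / M%:R ^+ 2) +
  (2 * t)^-1 * \sum_(k | k != grid0) grid_coef D k ^+ 2 / grid_eigen k.
Proof.
move=> t0 fL D0.
rewrite grid_coef_pairing (bigD1 grid0)//= (grid_coef0 D0) mulr0 add0r.
apply: (@le_trans _ _ (t / 2 * (\sum_k grid_eigen k * grid_coef f k ^+ 2) +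
  (2 * t)^-1 * \sum_(k | k != grid0) grid_coef D k ^+ 2 / grid_eigen k)).
  rewrite [X in t / 2 * X](bigD1 grid0)//= mulrDr -addrA.
  apply: ler_wpDl.
    have t20 : 0 <= t / 2 by rewrite ltW// divr_gt0.
    apply: mulr_ge0 => //; apply: mulr_ge0; last exact: sqr_ge0.
    by apply: sumr_ge0 => i _; exact: cos_eigen_ge0.
  rewrite !mulr_sumr -big_split/=; apply: ler_sum => k k0.
  have := grid_eigen_gt0 k0.
  move: (grid_eigen k) (grid_coef f k) (grid_coef D k) => e a b e0.
  have te : 0 < 2 * t * e by rewrite !mulr_gt0.
  (* [a b <= t e a^2 / 2 + b^2 / (2 t e)], by completing the square. *)
  have -> : t / 2 * (e * a ^+ 2) + (2 * t)^-1 * (b ^+ 2 / e) =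
    a * b + (t * e * a - b) ^+ 2 / (2 * t * e).
    by field; rewrite !gt_eqF.
  by rewrite lerDl divr_ge0 ?sqr_ge0// ltW.
rewrite lerD2r ler_pM2l ?divr_gt0// grid_gradient_energy.
apply: (@le_trans _ _ (\sum_(i < d) \sum_(x : grid) M%:R^-1 ^+ 2)).
  apply: ler_sum => i _; apply: ler_sum => x _.
  by rewrite -real_normK ?num_real// ler_pXn2r// nnegrE ?normr_ge0.
rewrite !sumr_const card_ffun !card_ord -[leLHS]mulr_natr -[X in X * _ <= _]mulr_natr natrX.
by rewrite exprVn le_eqVlt; apply/orP; left; apply/eqP; ring.
Qed.

End GridFourier.

(** * The cut norm and finitely valued random variables *)

Section SignedCutNorm.
Context {R : realType}.

(** With equal coefficients the worst signs are those of [r], and [\sum_a |r a|] is a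
difference of two sums over subsets. *)
Lemma sum_le_subset_sums (I : finType) (r phi : I -> R) (B c : R) :
  0 <= B -> (forall a, `|phi a| <= B) ->
  (forall S : {set I}, `|\sum_(a in S) r a| <= c) ->
  `|\sum_a phi a * r a| <= 2 * B * c.
Proof.
move=> B0 phiB rc.
apply: (@le_trans _ _ (B * \sum_a `|r a|)).
  apply: le_trans (ler_norm_sum _ _ _) _.
  by rewrite mulr_sumr; apply: ler_sum => a _; rewrite normrM ler_wpM2r.
rewrite (mulrC 2) -mulrA ler_wpM2l//.
rewrite (bigID [pred a | 0 <= r a])/=.
have half (Q : pred I) : `|\sum_(a | Q a) r a| <= c.
  by have := rc (finset Q); under eq_bigl do rewrite inE.
have := half [pred a | ~~ (0 <= r a)]; have := half [pred a | 0 <= r a].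
rewrite [X in _ -> _ -> X + _ <= _](eq_bigr r) => [|a ra]; last by rewrite ger0_norm.
rewrite [X in _ -> _ -> _ + X <= _](eq_bigr (fun a => - r a)) => [|a]; last first.
  by rewrite -ltNge => /ltW ra; rewrite ler0_norm.
rewrite sumrN !ler_norml; 
set u := \sum_(_ | _) _; set v := \sum_(_ | _) _.
by move=> /andP[H1 H2] /andP[H3 H4]; lra.
Qed.

(** The mixing coefficient bounds a joint law minus the product of its marginals on
rectangles only, that is, in cut norm.  The form with bounded arguments is
controlled by [sum_le_subset_sums], used once in each variable. *)
Lemma bilinear_le_cut (I J : finType) (m : I -> J -> R)
    (phi : I -> R) (psi : J -> R) (B c : R) :
  0 <= B -> (forall a, `|phi a| <= B) -> (forall b, `|psi b| <= B) ->
  (forall (S : {set I}) (S' : {set J}),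
    `|\sum_(a in S) \sum_(b in S') m a b| <= c) ->
  `|\sum_a \sum_b phi a * psi b * m a b| <= 4 * B ^+ 2 * c.
Proof.
move=> B0 phiB psiB mc.
have -> : 4 * B ^+ 2 * c = 2 * B * (2 * B * c) by ring.
under eq_bigr => a _ do (under eq_bigr do rewrite -mulrA; rewrite -mulr_sumr).
apply: sum_le_subset_sums => // S; rewrite exchange_big/=.
under eq_bigr do rewrite -mulr_sumr.
apply: sum_le_subset_sums => // S'; rewrite exchange_big/=; exact: mc.
Qed.

End SignedCutNorm.

Section FiniteValued.
Context {disp : measure_display} {T : measurableType disp} {R : realType}.
Variable P : probability T R.

Definition pr (A : set T) : R := fine (P A).

Lemma prE A : measurable A -> P A = (pr A)%:E.
Proof. by move=> mA; rewrite fineK// fin_num_measure. Qed.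

Definition finite_rv (I : finType) (c : T -> I) :=
  forall a, measurable (c @^-1` [set a]).

Lemma finite_rv_preimage (I : finType) (c : T -> I) (S : {set I}) :
  finite_rv c -> measurable (c @^-1` [set` S]).
Proof.
move=> mc; rewrite -[X in measurable X](_ : \bigcup_(a in [set` S]) (c @^-1` [set a]) = _).
  by apply: fin_bigcup_measurable => // a _; exact: mc.
apply/seteqP; split => [w [a aS caw]|w wS]; last by exists (c w).
by rewrite /preimage/= caw.
Qed.

Lemma finite_rv_indicE (I : finType) (c : T -> I) (phi : I -> R) w :
  (phi (c w))%:E = (\sum_a ((phi a)%:E * (\1_(c @^-1` [set a]) w)%:E))%E.
Proof.
rewrite (bigD1 (c w))//= indicE mem_set//= mule1 big1 ?adde0// => a.
move=> aw; rewrite indicE memNset ?mule0// => /= /eqP.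
by rewrite eq_sym (negbTE aw).
Qed.

Lemma finite_rv_integrable (I : finType) (c : T -> I) (phi : I -> R) :
  finite_rv c -> P.-integrable setT (fun w => (phi (c w))%:E).
Proof.
move=> mc; rewrite (funext (finite_rv_indicE c phi)).
apply: integrable_sum => // a _; apply: integrableZl => //.
exact: integrable_indic.
Qed.

(** The transfer formula, which reduces the moments of the discretized sample to
finite sums. *)
Lemma finite_rv_integral (I : finType) (c : T -> I) (phi : I -> R) :
  finite_rv c ->
  (\int[P]_w (phi (c w))%:E = (\sum_a phi a * pr (c @^-1` [set a]))%:E)%E.
Proof.
move=> mc; rewrite (funext (finite_rv_indicE c phi)).
have mI a : P.-integrable setT (fun w => (\1_(c @^-1` [set a]) w)%:E : \bar R).
  exact: integrable_indic.
rewrite integral_sum// => [|a]; last exact: integrableZl.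
rewrite -sumEFin; apply: eq_bigr => a _.
rewrite integralZl// integral_indic// setIT EFinM; congr (_ * _)%E; exact: prE.
Qed.

Lemma pr_finite_rv (I : finType) (c : T -> I) (S : {set I}) : finite_rv c ->
  pr (c @^-1` [set` S]) = \sum_(a in S) pr (c @^-1` [set a]).
Proof.
move=> mc; have mS := finite_rv_preimage S mc.
have := finite_rv_integral (fun a => (a \in S)%:R) mc.
have -> : (fun w => ((c w \in S)%:R : R)%:E) = EFin \o \1_(c @^-1` [set` S]).
  by apply/funext => w /=; rewrite indicE; congr ((nat_of_bool _)%:R%:E); apply/idP/idP; rewrite inE.
rewrite integral_indic// setIT [LHS]prE// => -[->].
rewrite [RHS]big_mkcond/=; apply: eq_bigr => a _.
by case: ifP => _; rewrite ?mul1r ?mul0r.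
Qed.

End FiniteValued.

(** * Second moments under strong mixing *)

Section MixingCovariance.
Context {disp disp' : measure_display} {T : measurableType disp}
  {V : measurableType disp'} {R : realType}.
Variables (P : probability T R) (Z : nat -> T -> V).
Hypothesis mZ : forall k, measurable_fun setT (Z k).
Variables (I : finType) (g : V -> I).
Hypothesis mg : forall a, measurable (g @^-1` [set a]).

Lemma finite_rv_comp k : finite_rv (g \o Z k).
Proof. by move=> a; rewrite -[X in measurable X]setTI; exact: (mZ k measurableT (mg a)). Qed.

Lemma mixing_set_bound (j k l : nat) (a : R) (A B : set V) : measurable A -> measurable B ->
  (l <= `|j - k|)%N -> mixing P Z l = a%:E ->
  `|pr P ((Z j @^-1` A) `&` (Z k @^-1` B)) -
    pr P (Z j @^-1` A) * pr P (Z k @^-1` B)| <= a.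
Proof.
move=> mA mB ljk mixa.
have mjA : measurable (Z j @^-1` A) by rewrite -[X in measurable X]setTI; exact: (mZ j measurableT mA).
have mkB : measurable (Z k @^-1` B) by rewrite -[X in measurable X]setTI; exact: (mZ k measurableT mB).
rewrite -lee_fin -mixa.
apply: (@le_trans _ _ (rosenblatt P (g_sigma_algebra_preimage (Z j))
                     (g_sigma_algebra_preimage (Z k)))).
  apply: ereal_sup_ubound.
  exists (Z j @^-1` A), (Z k @^-1` B); split.
  - by exists A => //; rewrite setTI.
  - by exists B => //; rewrite setTI.
  by rewrite !prE ?EFinB ?EFinM//; exact: measurableI.
by apply: ereal_sup_ubound; exists j, k.
Qed.

(** By the transfer formula the integral is the value at [(phi, phi)] of the bilinear
form of the joint law of [(Z j, Z k)]; subtracting the product of the marginals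
does not change it because [phi (g (Z j))] is centered. *)
Lemma mixing_covariance (phi : I -> R) (B a : R) (j k l : nat) :
  0 <= B -> (forall i, `|phi i| <= B) ->
  (l <= `|j - k|)%N -> mixing P Z l = a%:E ->
  (\int[P]_w (phi (g (Z j w)))%:E = 0)%E ->
  (\int[P]_w (phi (g (Z j w)) * phi (g (Z k w)))%:E <= (4 * B ^+ 2 * a)%:E)%E.
Proof.
move=> B0 phiB ljk mixa Ej.
have cj := finite_rv_comp j; have ck := finite_rv_comp k.
pose c w := (g (Z j w), g (Z k w)).
have cE b b' : c @^-1` [set (b, b')] =
    (g \o Z j) @^-1` [set b] `&` (g \o Z k) @^-1` [set b'].
  by apply/seteqP; split => w /= [<- <-].
have mc : finite_rv c by move=> [b b']; rewrite cE; exact: measurableI.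
have := finite_rv_integral P (fun u : I * I => phi u.1 * phi u.2) mc => /= ->.
rewrite lee_fin (_ : \sum_(u : I * I) _ =
  \sum_b \sum_b' phi b * phi b' * pr P (c @^-1` [set (b, b')])); last first.
  by rewrite pair_bigA; apply: eq_bigr => -[].
have {Ej} Ej : \sum_b phi b * pr P ((g \o Z j) @^-1` [set b]) = 0.
  by have := finite_rv_integral P phi cj; rewrite /= Ej => -[].
pose mm b b' := pr P (c @^-1` [set (b, b')]) -
  pr P ((g \o Z j) @^-1` [set b]) * pr P ((g \o Z k) @^-1` [set b']).
have -> : \sum_b \sum_b' phi b * phi b' * pr P (c @^-1` [set (b, b')]) =
    \sum_b \sum_b' phi b * phi b' * mm b b'.
  rewrite -[LHS]subr0; under [RHS]eq_bigr => b _ do (under eq_bigr do rewrite mulrBr; rewrite sumrB).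
  rewrite sumrB; congr (_ - _).
  rewrite exchange_big/= big1// => b' _.
  under eq_bigr do rewrite mulrACA.
  by rewrite -mulr_suml Ej mul0r.
apply: le_trans (ler_norm _) _.
apply: bilinear_le_cut => // S S'.
under eq_bigr do rewrite sumrB -mulr_sumr.
rewrite sumrB -mulr_suml -!pr_finite_rv//.
have -> : \sum_(b in S) \sum_(b' in S') pr P (c @^-1` [set (b, b')]) =
    pr P ((g \o Z j) @^-1` [set` S] `&` (g \o Z k) @^-1` [set` S']).
  rewrite [LHS]pair_big_dep/=.
  under eq_bigr do rewrite -surjective_pairing.
  rewrite (eq_bigl [in finset.setX S S']) => [|u]; last by case: u => b b'; rewrite /= finset.in_setX.
  rewrite -pr_finite_rv//; congr (pr P _).
  by apply/seteqP; split => w /=; rewrite finset.in_setX => /andP.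
have mS (U : {set I}) : measurable (g @^-1` [set` U]).
  rewrite (_ : _ @^-1` _ = \bigcup_(b in [set` U]) (g @^-1` [set b])).
    by apply: fin_bigcup_measurable => // b _; exact: mg.
  apply/seteqP; split => [w wU|w [b bU gb]]; first by exists (g w).
  by rewrite /preimage/= gb.
exact: (mixing_set_bound (mS S) (mS S') ljk mixa).
Qed.

Lemma sum_distance_le (b : nat -> R) (A : R) (n j : nat) : (j < n)%N ->
  (forall l, 0 <= b l) -> (forall p, \sum_(1 <= l < p) b l <= A) ->
  \sum_(0 <= k < n | k != j :> nat) b `|j - k|%N <= 2 * A.
Proof.
move=> jn b0 bA.
rewrite (big_cat_nat _ (ltnW jn))//= big_mkcond/= [X in _ + X]big_mkcond/=.
rewrite (big_ltn jn) eqxx add0r.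
have -> : 2 * A = A + A by ring.
apply: lerD.
  apply: le_trans (bA j.+1); rewrite big_nat_rev big_add1/=.
  rewrite !big_seq; apply: ler_sum => k; rewrite mem_index_iota => kj.
  case: ifP => // _; rewrite le_eqVlt; apply/orP; left; apply/eqP; congr b; lia.
apply: le_trans (bA (n - j)%N).
rewrite -[j.+1]add1n big_addn !big_seq; apply: ler_sum => k; rewrite mem_index_iota => kj.
case: ifP => // _; rewrite le_eqVlt; apply/orP; left; apply/eqP; congr b; lia.
Qed.

Lemma square_mean_integrable (phi : I -> R) n :
  P.-integrable setT (fun w => ((n%:R^-1 * \sum_(i < n) phi (g (Z i w))) ^+ 2)%:E : \bar R).
Proof.
pose c w := [ffun i : 'I_n => g (Z i w)].
have mc : finite_rv c.
  move=> u; rewrite (_ : _ @^-1` _ =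
    \bigcap_(i in [set: 'I_n]) ((g \o Z i) @^-1` [set u i])); last first.
    apply/seteqP; split => [w /= <- i _|w cw]/=; first by rewrite ffunE.
    by apply/ffunP => i; rewrite ffunE; exact: cw.
  apply: fin_bigcap_measurable => // i _; exact: finite_rv_comp.
have := finite_rv_integrable P
  (fun u : {ffun 'I_n -> I} => (n%:R^-1 * \sum_i phi (u i)) ^+ 2 : R) mc.
rewrite (_ : (fun w => _) = (fun w =>
  ((n%:R^-1 * \sum_(i < n) phi (g (Z i w))) ^+ 2)%:E : \bar R))//.
apply/funext => w; congr ((_ * _) ^+ 2)%:E.
by apply: eq_bigr => i _; rewrite ffunE.
Qed.

(** In the double sum of covariances, each row contributes [B^2] on the diagonal and
at most [4 B^2 (2 A)] off it, a given distance to the diagonal being attained at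
most twice. *)
Lemma square_mean_bound (phi : I -> R) (B A : R) (a : nat -> R) n :
  0 <= B -> (forall i, `|phi i| <= B) -> (0 < n)%N ->
  (forall l, (0 < l)%N -> mixing P Z l = (a l)%:E) ->
  (forall l, 0 <= a l) -> (forall p, \sum_(1 <= l < p) a l <= A) ->
  (forall k, (\int[P]_w (phi (g (Z k w)))%:E = 0)%E) ->
  (\int[P]_w ((n%:R^-1 * \sum_(i < n) phi (g (Z i w))) ^+ 2)%:E <=
     (B ^+ 2 * (1 + 8 * A) / n%:R)%:E)%E.
Proof.
move=> B0 phiB n0 mixa a0 aA E0.
have nR : 0 < n%:R :> R by rewrite ltr0n.
have EE w : ((n%:R^-1 * \sum_(i < n) phi (g (Z i w))) ^+ 2)%:E =
  (\sum_(i < n) \sum_(j < n) ((n%:R^-2)%:E * (phi (g (Z i w)) * phi (g (Z j w)))%:E))%E.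
  rewrite exprMn [X in _ * X]expr2 big_distrlr/= exprVn mulr_sumr -sumEFin.
  by apply: eq_bigr => i _; rewrite mulr_sumr -sumEFin.
have mij (i j : 'I_n) : P.-integrable setT (fun w => (phi (g (Z i w)) * phi (g (Z j w)))%:E : \bar R).
  pose c w := (g (Z i w), g (Z j w)).
  have mc : finite_rv c.
    move=> [b b']; rewrite (_ : _ @^-1` _ =
      (g \o Z i) @^-1` [set b] `&` (g \o Z j) @^-1` [set b']).
      by apply: measurableI; exact: finite_rv_comp.
    by apply/seteqP; split => w /= [<- <-].
  exact: (finite_rv_integrable P (fun u : I * I => phi u.1 * phi u.2) mc).
under eq_integral do rewrite EE.
rewrite integral_sum// => [|i]; last first.
  by apply: integrable_sum => // j _; exact: integrableZl.
under eq_bigr => i _.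
  rewrite integral_sum// => [|j]; last exact: integrableZl.
  under eq_bigr do rewrite integralZl//.
  over.
apply: (@le_trans _ _ (\sum_(i < n) (n%:R ^- 2 * (B ^+ 2 * (1 + 8 * A)))%:E)%E).
  apply: lee_sum => i _.
  apply: (@le_trans _ _ (\sum_(j < n) (n%:R ^- 2 *
     (if j == i :> nat then B ^+ 2 else 4 * B ^+ 2 * a `|i - j|%N))%:E)%E).
    apply: lee_sum => j _; rewrite EFinM lee_pmul2l//; last first.
      by rewrite lte_fin invr_gt0 exprn_gt0.
    have [ij|ij] := eqVneq (j : nat) i; last first.
      by apply: (@mixing_covariance _ _ _ _ _ `|i - j|%N) => //; apply: mixa; lia.
    rewrite -[leRHS]mule1 -(@probability_setT _ _ _ P) -integral_cst//.
    rewrite (val_inj ij); apply: le_integral => //=.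
      by apply: finite_measure_integrable_cst.
    by move=> w _; rewrite lee_fin -expr2 -real_normK ?num_real// ler_pXn2r ?nnegrE.
  rewrite sumEFin lee_fin -mulr_sumr ler_wpM2l ?invr_ge0 ?exprn_ge0//.
  rewrite (bigD1 i)//= eqxx mulrDr mulr1 lerD2l.
  rewrite (eq_bigr (fun j : 'I_n => 4 * B ^+ 2 * a `|i - j|%N)) => [|j ji]; last first.
    by rewrite -val_eqE/= in ji; rewrite (negbTE ji).
  rewrite -mulr_sumr.
  have -> : B ^+ 2 * (8 * A) = 4 * B ^+ 2 * (2 * A) by ring.
  rewrite ler_wpM2l ?mulr_ge0 ?sqr_ge0//.
  have := sum_distance_le (ltn_ord i) a0 aA.
  by rewrite big_mkord.
rewrite sumEFin lee_fin sumr_const card_ord -mulr_natr le_eqVlt; apply/orP; left.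
by apply/eqP; field; rewrite gt_eqF.
Qed.

End MixingCovariance.

(** * Lattice sums and the choice of the mesh *)

Section LatticeSums.
Context {R : realType}.
Variables d m : nat.
Local Notation M := m.+1.
Local Notation grid := {ffun 'I_d -> 'I_M}.

Definition lattice_sum : R :=
  \sum_(k : grid | k != grid0 d m) (\sum_i (k i)%:R ^+ 2)^-1.

(** The number of frequencies with [i]-th coordinate equal to [r] and all the others at
most [r], written as a sum of products so that it factorizes. *)
Lemma sum_grid_max (i : 'I_d) (r : 'I_M) :
  \sum_(k : grid) \prod_j (if j == i then k j == r else (k j <= r)%N)%:R =
  r.+1%:R ^+ d.-1 :> R.
Proof.
rewrite -(bigA_distr_bigA (fun j (z : 'I_M) => (if j == i then z == r else (z <= r)%N)%:R)).
rewrite (bigD1 i)//= eqxx (bigD1 r)//= eqxx big1 ?addr0 ?mul1r; last first.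
  by move=> z /negbTE ->.
rewrite (eq_bigr (fun=> r.+1%:R)) => [|j /negbTE ->]; last first.
  rewrite -natr_sum -big_mkcond/= -(big_ord_widen _ (fun=> 1%N) (ltn_ord r)).
  by rewrite sum1_card card_ord.
by rewrite prodr_const cardC1 card_ord.
Qed.

(** A nonzero [k] has a largest coordinate [k_i = r > 0], and [1 / |k|^2 <= 1 / r^2]. *)
Lemma lattice_sum_le : lattice_sum <=
  d%:R * \sum_(1 <= r < M) r.+1%:R ^+ d.-1 / r%:R ^+ 2.
Proof.
have -> : d%:R * \sum_(1 <= r < M) r.+1%:R ^+ d.-1 / r%:R ^+ 2 =
    \sum_(i < d) \sum_(r < M | r != ord0) \sum_(k : grid)
      (\prod_j (if j == i then k j == r else (k j <= r)%N)%:R) / r%:R ^+ 2 :> R.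
  under [RHS]eq_bigr => i _ do under eq_bigr do rewrite -mulr_suml sum_grid_max.
  rewrite sumr_const card_ord -[RHS]mulr_natl; congr (_ * _).
  by rewrite big_add1/= big_mkord [RHS]big_mkcond [RHS]big_ord_recl/= add0r.
under eq_bigr do rewrite exchange_big.
rewrite exchange_big/= /lattice_sum big_mkcond/=.
apply: ler_sum => k _.
have t0 i (r : 'I_M) : 0 <= (\prod_j (if j == i then k j == r else (k j <= r)%N)%:R) / r%:R ^+ 2 :> R.
  by rewrite divr_ge0 ?exprn_ge0// prodr_ge0.
case: ifPn => k0; last by do 2 (apply: sumr_ge0 => ? _).
have [i0 _|d0] := pickP 'I_d; last first.
  by case/eqP: k0; apply/ffunP => i; have := d0 i.
have [i _ imax] := arg_maxnP (fun i => k i : nat) (isT : xpredT i0).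
have ki : k i != ord0.
  apply: contra k0 => /eqP ki; apply/eqP/ffunP => j; rewrite ffunE; apply/val_inj => /=.
  by have := imax j isT; rewrite ki /= leqn0 => /eqP.
rewrite [leRHS](bigD1 i)//= [X in _ <= X + _](bigD1 (k i))//= -addrA.
apply: ler_wpDr.
  by rewrite addr_ge0//; [apply: sumr_ge0|apply: sumr_ge0 => ? _; apply: sumr_ge0].
rewrite [X in _ <= X / _]big1 ?mul1r; last first.
  move=> j _; have kji : (k j <= k i)%N := imax j isT.
  by case: ifPn => [/eqP ->|_]; rewrite ?eqxx// kji.
have k2 : 0 < (k i)%:R ^+ 2 :> R by rewrite exprn_gt0// ltr0n lt0n.
rewrite lef_pV2 ?posrE//; last by rewrite (bigD1 i)//= ltr_pwDl// sumr_ge0// => j _; exact: sqr_ge0.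
by rewrite (bigD1 i)//= lerDl sumr_ge0// => j _; exact: sqr_ge0.
Qed.

End LatticeSums.

Section Rates.
Context {R : realType}.

(** The induction carries the sharper bound [2 - 1 / n]. *)
Lemma sum_inv_sq_le n : \sum_(1 <= r < n.+1) (r%:R ^+ 2)^-1 <= 2 :> R.
Proof.
have [->|n0] := posnP n; first by rewrite big_geq.
suff : \sum_(1 <= r < n.+1) (r%:R ^+ 2)^-1 <= 2 - n%:R^-1 :> R.
  by move=> /le_trans; apply; rewrite gerBl invr_ge0.
elim: n n0 => // n IH _.
have [->|n0] := posnP n; first by rewrite big_nat1 expr1n invr1; lra.
rewrite big_nat_recr//=; apply: le_trans (lerD (IH n0) (lexx _)) _.
have {n0} : 0 < n%:R :> R by rewrite ltr0n.
rewrite -[n.+1%:R]natr1; move: (n%:R : R) => x x0.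
have x1 : 0 < x + 1 by lra.
rewrite -subr_ge0 (_ : _ - _ = (x * (x + 1) ^+ 2)^-1).
  by rewrite invr_ge0 mulr_ge0 ?exprn_ge0// ltW.
by field; rewrite !gt_eqF.
Qed.

(** The increment [1 / (n + 1)] is at most [- ln (1 - 1 / (n + 1))]. *)
Lemma harmonic_le_ln n : (0 < n)%N ->
  \sum_(1 <= r < n.+1) r%:R^-1 <= 1 + ln n%:R :> R.
Proof.
elim: n => // n IH _.
have [->|n0] := posnP n; first by rewrite big_nat1 invr1 ln1 addr0.
rewrite big_nat_recr//=; apply: le_trans (lerD (IH n0) (lexx _)) _.
have nR : 0 < n%:R :> R by rewrite ltr0n.
have n1R : 0 < n.+1%:R :> R by rewrite ltr0n.
rewrite -addrA lerD2l -lerBrDl -[_ - _]opprB -ln_div ?posrE//.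
have -> : n%:R / n.+1%:R = 1 + - n.+1%:R^-1 :> R.
  by rewrite -[n.+1%:R]natr1 in n1R *; field; rewrite gt_eqF.
rewrite lerNr; apply: le_ln1Dx.
by rewrite ltrN2 invf_lt1// ltr1n ltnS.
Qed.

Lemma sum_lattice_radial_le (d m : nat) : (0 < d)%N ->
  lattice_sum d m <=
  d%:R * 2 ^+ d.-1 * \sum_(1 <= r < m.+1) r%:R ^+ d.-1 / r%:R ^+ 2 :> R.
Proof.
move=> d0; apply: le_trans (lattice_sum_le d m) _.
rewrite -mulrA ler_wpM2l// mulr_sumr !big_seq; apply: ler_sum => r.
rewrite mem_index_iota => /andP[r1 _].
rewrite mulrA ler_wpM2r ?invr_ge0 ?exprn_ge0// -exprMn.
apply: lerXn2r; rewrite ?nnegrE ?mulr_ge0//.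
by rewrite -natrM ler_nat; lia.
Qed.

Lemma near_ln_ge1 : \forall n \near \oo, 1 <= ln (n%:R : R).
Proof.
exists (Num.truncn (expR 1 : R)).+1 => // n /=.
rewrite truncn_lt_nat ?expR_ge0// => en.
by rewrite -[X in X <= _]expRK ler_ln ?posrE ?expR_gt0 ?ltW// (lt_trans (expR_gt0 1)).
Qed.

(** The lattice sum is bounded in dimension 1, logarithmic in dimension 2 and of order
[M^(d-2)] in dimension [d >= 3]; taking [M] of order [n^(1/d)] in the last case makes
the mesh and the fluctuations comparable. *)
Lemma grid_size_rate (d : nat) : (0 < d)%N ->
  exists C1 C2 : R, 0 <= C1 /\ 0 <= C2 /\ \forall n \near \oo, exists m,
    [/\ 0 < rate R d n, m.+1%:R^-1 <= C1 * rate R d n &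
        lattice_sum d m / n%:R <= C2 * rate R d n ^+ 2].
Proof.
case: d => // -[|[|d]] _; rewrite /rate/=.
- exists 1, 2; do 2 split => //.
  exists 1%N => // n /= n0; exists n.
  have nR : 0 < n%:R :> R by rewrite ltr0n.
  have n1 : 1 <= n%:R :> R by rewrite ler1n.
  have sn : 0 < Num.sqrt n%:R :> R by rewrite sqrtr_gt0.
  rewrite !div1r exprVn sqr_sqrtr ?(ltW nR)//; split.
  + by rewrite invr_gt0.
  + rewrite lef_pV2 ?posrE// -(@ler_pXn2r _ 2)// ?nnegrE ?ltW// sqr_sqrtr ?ltW//.
    by rewrite -natrX ltr_nat; nia.
  + rewrite ler_pM2r ?invr_gt0//.
    apply: le_trans (@sum_lattice_radial_le 1 n isT) _.
    rewrite /= expr0 !mul1r; under eq_bigr do rewrite expr0 div1r.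
    exact: sum_inv_sq_le.
- exists 1, 8; do 2 split => //.
  near=> n; exists n.
  have ln1 : 1 <= ln (n%:R : R) by near: n; exact: near_ln_ge1.
  have n0 : (0 < n)%N by near: n; exists 1%N.
  have nR : 0 < n%:R :> R by rewrite ltr0n.
  have n1 : 1 <= n%:R :> R by rewrite ler1n.
  have q0 : 0 < ln n%:R / n%:R :> R by rewrite divr_gt0// (lt_le_trans _ ln1).
  have sn : 0 < Num.sqrt (ln n%:R / n%:R) :> R by rewrite sqrtr_gt0.
  rewrite (sqr_sqrtr (ltW q0)) mul1r; split => //.
  + rewrite -(@ler_pXn2r _ 2)// ?nnegrE ?invr_ge0 ?(ltW sn)// (sqr_sqrtr (ltW q0)).
    apply: (@le_trans _ _ n%:R^-1); last by rewrite ler_peMl// invr_ge0 ltW.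
    rewrite exprVn lef_pV2 ?posrE ?exprn_gt0//.
    by rewrite -natrX ler_nat; nia.
  + rewrite mulrA ler_pM2r ?invr_gt0//.
    apply: le_trans (@sum_lattice_radial_le 2 n isT) _.
    rewrite /= expr1 big_seq.
    rewrite (eq_bigr (fun r => r%:R^-1)) => [|r]; last first.
      rewrite mem_index_iota => /andP[r1 _].
      by field; rewrite pnatr_eq0; lia.
    by rewrite -big_seq; have := harmonic_le_ln n0; lra.
- set D := d.+3.
  have [K [K0 SK]] : exists K : R, 0 <= K /\ forall m, lattice_sum D m <=
      K * \sum_(1 <= r < m.+1) r%:R ^+ D.-1 / r%:R ^+ 2.
    exists (D%:R * 2 ^+ D.-1); split; first by rewrite mulr_ge0// exprn_ge0.
    by move=> m; exact: sum_lattice_radial_le.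
  exists 1, (K * 2 ^+ d.+1).
  split=> //; split; first by rewrite mulr_ge0// exprn_ge0.
  exists 1%N => // n n1; have {n1}n0 : (0 < n)%N by exact: n1.
  have nR : 0 < n%:R :> R by rewrite ltr0n.
  set r := n%:R `^ (1 / D%:R).
  have rn : r ^+ D = n%:R.
    by rewrite -powR_mulrn ?powR_ge0// -powRrM divfK ?pnatr_eq0// powRr1// ltW.
  have r0 : 0 < r by rewrite powR_gt0.
  have r1 : 1 <= r.
    rewrite leNgt; apply/negP => r1.
    have : r ^+ D < 1 by rewrite exprn_ilt1// ltW.
    by rewrite rn ltNge ler1n n0.
  exists (Num.truncn r); set M := (Num.truncn r).+1.
  have /andP[Mr rM] := truncn_itv (ltW r0).
  have M2r : M%:R <= 2 * r by rewrite -[M%:R]natr1; lra.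
  rewrite !div1r; split.
  + by rewrite invr_gt0.
  + by rewrite lef_pV2 ?posrE ?ltr0n// ltW.
  + rewrite ler_pdivrMr// -rn.
    apply: le_trans (SK _) _; rewrite -[leRHS]mulrA -[leRHS]mulrA; apply: (ler_wpM2l K0).
    have -> : 2 ^+ d.+1 * (r^-1 ^+ 2 * r ^+ D) = (2 * r) ^+ d.+1.
      rewrite exprMn; congr (_ * _); rewrite /D -[d.+3]addn2 exprD.
      by field; rewrite gt_eqF.
    apply: (@le_trans _ _ (M%:R ^+ d.+1)); last first.
      by rewrite ler_pXn2r// nnegrE// mulr_ge0// ltW.
    apply: (@le_trans _ _ (\sum_(1 <= s < M) M%:R ^+ d)).
      rewrite !big_seq; apply: ler_sum => s; rewrite mem_index_iota => /andP[s1 sM].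
      rewrite /= -[d.+2]addn2 exprD mulfK ?expf_neq0 ?pnatr_eq0 -?lt0n//.
      by apply: lerXn2r; rewrite ?nnegrE// ler_nat ltnW.
    rewrite sumr_const_nat -[leLHS]mulr_natl exprS ler_wpM2r ?exprn_ge0// ler_nat.
    exact: leq_subr.
Unshelve. all: by end_near.
Qed.

End Rates.

(** * From the unit cube to the grid *)

Section Discretization.
Context {R : realType}.
Variables d m : nat.
Local Notation M := m.+1.
Local Notation grid := {ffun 'I_d -> 'I_M}.

(** The minimum keeps the right end point [t = 1] in the last cell. *)
Definition cell1 (t : R) : 'I_M := inord (minn (Num.truncn (M%:R * t)) m).

Definition cell (x : d.-tuple R) : grid := [ffun i => cell1 (tnth x i)].

Definition grid_point (q : grid) : d.-tuple R := [tuple (q i)%:R / M%:R | i < d].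

Let M0 : 0 < M%:R :> R. Proof. by rewrite ltr0n. Qed.

Lemma cell1E t : cell1 t = minn (Num.truncn (M%:R * t)) m :> nat.
Proof. by rewrite /cell1 inordK// ltnS geq_minr. Qed.

Lemma cell1_close t : 0 <= t <= 1 -> `|t - (cell1 t)%:R / M%:R| <= M%:R^-1.
Proof.
move=> /andP[t0 t1].
have -> : t - (cell1 t)%:R / M%:R = (M%:R * t - (cell1 t)%:R) * M%:R^-1.
  by field; rewrite gt_eqF.
rewrite normrM [X in _ * X <= _]ger0_norm ?invr_ge0 ?(ltW M0)//.
rewrite ler_piMl ?invr_ge0 ?(ltW M0)// cell1E.
have Mt0 : 0 <= M%:R * t by rewrite mulr_ge0// ltW.
have MtM : M%:R * t <= M%:R by rewrite ler_piMr// ltW.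
have /andP[kl ku] := truncn_itv Mt0.
rewrite ler_norml; have [km|km] := leqP (Num.truncn (M%:R * t)) m.
  rewrite -[(Num.truncn _).+1%:R]natr1 in ku; apply/andP; split; lra.
have {}km : M%:R <= (Num.truncn (M%:R * t))%:R :> R by rewrite ler_nat.
by move: km kl MtM; rewrite -[M%:R]natr1 => km kl MtM; apply/andP; split; lra.
Qed.

(** [cell1] is monotone, so its fibers are intervals. *)
Lemma measurable_cell1 (q : 'I_M) : measurable (cell1 @^-1` [set q]).
Proof.
apply: is_interval_measurable => x y /= xq yq z /andP[xz zy].
have mono u v : u <= v -> (cell1 u <= cell1 v)%N.
  move=> uv; rewrite !cell1E leq_min geq_minr andbT.
  by rewrite (leq_trans (geq_minl _ _))// le_truncn// ler_wpM2l// ltW.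
apply/val_inj/eqP => /=; rewrite eqn_leq.
by rewrite -{1}yq -xq !mono.
Qed.

Lemma measurable_cell (q : grid) : measurable (cell @^-1` [set q]).
Proof.
rewrite (_ : _ @^-1` _ = \bigcap_(i in [set: 'I_d])
    ((fun x : d.-tuple R => tnth x i) @^-1` (cell1 @^-1` [set q i]))).
  apply: fin_bigcap_measurable => // i _.
  rewrite -[X in measurable X]setTI.
  exact: (measurable_tnth i measurableT (measurable_cell1 (q i))).
apply/seteqP; split => [x /= <- i _/=|x xq/=]; first by rewrite ffunE.
by apply/ffunP => i; rewrite ffunE; exact: (xq i).
Qed.

Lemma edist_cell (x : d.-tuple R) : (forall i, 0 <= tnth x i <= 1) ->
  edist x (grid_point (cell x)) <= d%:R / M%:R.
Proof.
move=> x01; apply: le_trans (edist_le_sum _ _) _.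
apply: (@le_trans _ _ (\sum_(i < d) M%:R^-1)).
  by apply: ler_sum => i _; rewrite tnth_mktuple ffunE cell1_close.
by rewrite sumr_const card_ord -[leLHS]mulr_natl.
Qed.

Lemma edist_grid_step i (q : grid) :
  edist (grid_point (grid_step i q)) (grid_point q) <= M%:R^-1.
Proof.
apply: le_trans (edist_le_sum _ _) _.
rewrite (bigD1 i)//= big1 ?addr0 => [|j /negbTE ji]; last first.
  by rewrite !tnth_mktuple ffunE ji subrr normr0.
rewrite !tnth_mktuple ffunE eqxx -mulrBl normrM.
rewrite [X in _ * X <= _]ger0_norm ?invr_ge0 ?(ltW M0)//.
rewrite ler_piMl ?invr_ge0 ?(ltW M0)// inordK; last by rewrite ltnS geq_minr.
have qm : (q i <= m)%N by rewrite -ltnS.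
have [lt_qm|] := ltnP (q i) m.
  by rewrite (minn_idPl lt_qm) -[(q i).+1%:R]natr1 addrAC subrr add0r normr1.
by move=> mq; rewrite (minn_idPr (leq_trans mq (leqnSn _))) (_ : q i = m :> nat) ?subrr ?normr0//; lia.
Qed.

Variables (n : nat) (x y : nat -> d.-tuple R).
Hypothesis n0 : (0 < n)%N.
Hypothesis x01 : forall k i, 0 <= tnth (x k) i <= 1.
Hypothesis y01 : forall k i, 0 <= tnth (y k) i <= 1.

(** The rounded difference of the two empirical measures, as a density on the grid. *)
Definition cell_diff (q : grid) : R :=
  n%:R^-1 * \sum_(k < n) ((q == cell (y k))%:R - (q == cell (x k))%:R).

Lemma sum_cell_diff (F : grid -> R) : \sum_q F q * cell_diff q =
  n%:R^-1 * \sum_(k < n) (F (cell (y k)) - F (cell (x k))).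
Proof.
have sum1 (a : grid) : \sum_q F q * (q == a)%:R = F a.
  rewrite (bigD1 a)//= eqxx mulr1 big1 ?addr0// => q /negbTE ->.
  by rewrite mulr0.
under eq_bigr do rewrite /cell_diff mulrCA mulr_sumr.
rewrite -mulr_sumr exchange_big/=; congr (_ * _); apply: eq_bigr => k _.
by under eq_bigr do rewrite mulrBr; rewrite sumrB !sum1.
Qed.

(** The estimate for a fixed outcome: matching, duality, rounding, then the dual bound
on the grid for the restriction of the potential, which varies by at most the mesh
along an edge. *)
Lemma W1_le_cos_coef t : 0 < t ->
  (W1 (empirical x n) (empirical y n) <=
   (2 * d%:R / M%:R + t / 2 * (d%:R * M%:R ^+ d / M%:R ^+ 2) +
    (2 * t)^-1 * \sum_(k | k != grid0 d m)
      (n%:R^-1 * \sum_(j < n) (grid_cos k (cell (y j)) - grid_cos k (cell (x j)))) ^+ 2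
        / grid_eigen k)%:E)%E.
Proof.
move=> t0.
have nR : 0 < n%:R :> R by rewrite ltr0n.
have [s [f [fL fd]]] := @assignment_duality R _ (@Pilot.Defs.edist R d) n x y
  (@edistxx R d) (@edistC R d) (@edist_triangle R d).
apply: le_trans (W1_empirical_le x y s n0) _; rewrite lee_fin.
have fabs a b : `|f a - f b| <= edist a b.
  by rewrite ler_norml fL andbT lerNl opprB edistC.
apply: (@le_trans _ _ (n%:R^-1 * \sum_(k < n) (f (y k) - f (x k)))).
  rewrite ler_pM2l ?invr_gt0// sumrB [X in _ <= X - _](reindex_inj (@perm_inj _ s))/=.
  by rewrite -sumrB; apply: ler_sum => k _.
pose F q := f (grid_point q).
apply: (@le_trans _ _ (2 * d%:R / M%:R +
   n%:R^-1 * \sum_(k < n) (F (cell (y k)) - F (cell (x k))))).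
  have -> : 2 * d%:R / M%:R = n%:R^-1 * \sum_(k < n) (2 * d%:R / M%:R) :> R.
    by rewrite sumr_const card_ord -[X in _ = _ * X]mulr_natl mulKf// gt_eqF.
  rewrite -mulrDr ler_pM2l ?invr_gt0// -big_split/=; apply: ler_sum => k _.
  have := fL (y k) (grid_point (cell (y k))).
  have := fL (grid_point (cell (x k))) (x k); rewrite edistC.
  have := edist_cell (x01 k); have := edist_cell (y01 k).
  rewrite /F (_ : 2 * d%:R / M%:R = d%:R / M%:R + d%:R / M%:R); last by ring.
  move: (_ / _) (edist _ _) (edist _ _) => a b c; lra.
rewrite -addrA lerD2l -sum_cell_diff.
have D0 : \sum_q cell_diff q = 0.
  have := sum_cell_diff (fun=> 1).
  under eq_bigr do rewrite mul1r.
  by move=> ->; rewrite big1 ?mulr0// => k _; rewrite subrr.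
have FL i q : `|F (grid_step i q) - F q| <= M%:R^-1.
  exact: le_trans (fabs _ _) (edist_grid_step i q).
apply: le_trans (grid_dual_bound t0 FL D0) _.
rewrite lerD2l ler_pM2l ?invr_gt0 ?mulr_gt0//.
apply: ler_sum => k _; rewrite /grid_coef.
under eq_bigr do rewrite mulrC.
by rewrite sum_cell_diff.
Qed.

End Discretization.

(** * The expected transport cost *)

Section Main.
Context {R : realType} {disp : measure_display} {T : measurableType disp}.
Variables (P : probability T R) (d : nat) (X Y : nat -> {RV P >-> d.-tuple R}).
Local Notation Z := (fun k w => (X k w, Y k w)).
Hypothesis X01 : forall (k : nat) (w : T) (i : 'I_d), 0 <= tnth (X k w) i <= 1.
Hypothesis Y01 : forall (k : nat) (w : T) (i : 'I_d), 0 <= tnth (Y k w) i <= 1.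
Hypothesis XY : forall (k : nat) (A : set (d.-tuple R)), measurable A ->
     distribution P (X k) A = distribution P (Y k) A.
Variables (a : nat -> R) (A : R).
Hypothesis mixa : forall l, (0 < l)%N -> mixing P Z l = (a l)%:E.
Hypothesis a0 : forall l, 0 <= a l.
Hypothesis aA : forall p, \sum_(1 <= l < p) a l <= A.

Variables (m n : nat) (tau : R).
Hypothesis n0 : (0 < n)%N.
Hypothesis tau0 : 0 < tau.
Local Notation M := m.+1.
Local Notation grid := {ffun 'I_d -> 'I_M}.

Definition cell_pair (z : d.-tuple R * d.-tuple R) : grid * grid :=
  (cell m z.1, cell m z.2).

Lemma measurable_cell_pair q : measurable (cell_pair @^-1` [set q]).
Proof.
rewrite (_ : _ @^-1` _ = (cell m @^-1` [set q.1]) `*` (cell m @^-1` [set q.2])).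
  by apply: measurableX; exact: measurable_cell.
by case: q => q1 q2; apply/seteqP; split => -[z1 z2]; rewrite /preimage/cell_pair/= => -[<- <-].
Qed.

(** [X k] and [Y k] have the same law. *)
Lemma expectation_cell_eq (F : grid -> R) k :
  (\int[P]_w (F (cell m (Y k w)) - F (cell m (X k w)))%:E = 0)%E.
Proof.
have mc (W : {RV P >-> d.-tuple R}) : finite_rv (cell m \o W).
  by move=> q; exact: (measurable_funPTI W (measurable_cell q)).
have iX := finite_rv_integrable P F (mc (X k)).
have iY := finite_rv_integrable P F (mc (Y k)).
under eq_integral do rewrite EFinB.
rewrite integralB_EFin//.
have := finite_rv_integral P F (mc (X k)) => /= ->.
have := finite_rv_integral P F (mc (Y k)) => /= ->.
rewrite -EFinB -sumrB big1// => q _; rewrite -mulrBr.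
apply/eqP; rewrite mulf_eq0 subr_eq0; apply/orP; right; apply/eqP.
by rewrite /pr; congr fine; have := XY k (measurable_cell q).
Qed.

(** [grid_cos k] is bounded by [(2 / M)^(d/2)], and the function of [Z j] averaged here is
a difference of two of its values. *)
Lemma cos_coef_second_moment k :
  (\int[P]_w ((n%:R^-1 * \sum_(j < n)
      (grid_cos k (cell m (Y j w)) - grid_cos k (cell m (X j w)))) ^+ 2)%:E <=
   (4 * (2 / M%:R) ^+ d * (1 + 8 * A) / n%:R)%:E)%E.
Proof.
pose phi (q : grid * grid) : R := grid_cos k q.2 - grid_cos k q.1.
have b0 : 0 <= (2 / M%:R) ^+ d :> R by rewrite exprn_ge0// divr_ge0.
pose B : R := 2 * Num.sqrt ((2 / M%:R) ^+ d).
have B0 : 0 <= B by rewrite mulr_ge0// sqrtr_ge0.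
have B2 : B ^+ 2 = 4 * (2 / M%:R) ^+ d.
  by rewrite exprMn sqr_sqrtr//; congr (_ * _); ring.
have phiB q : `|phi q| <= B.
  have cb (x : grid) : `|grid_cos k x| <= Num.sqrt ((2 / M%:R) ^+ d) :> R.
    rewrite -(@ler_pXn2r _ 2)// ?nnegrE ?sqrtr_ge0// sqr_sqrtr// real_normK ?num_real//.
    exact: grid_cos_sq_le.
  apply: le_trans (ler_normB _ _) _.
  by have := cb q.1; have := cb q.2; rewrite /B; lra.
rewrite -B2.
have mZ j : measurable_fun setT (Z j).
  by apply: measurable_fun_pair; exact: measurable_funPT.
apply: (square_mean_bound mZ measurable_cell_pair B0 phiB n0 mixa a0 aA).
by move=> j; exact: expectation_cell_eq.
Qed.

Lemma expected_W1_le :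
  (\int[P]_w W1 (empirical (fun k => X k w) n) (empirical (fun k => Y k w) n)
   <= (2 * d%:R / M%:R + d%:R / 2 * tau +
       2 * 2 ^+ d * (1 + 8 * A) * (lattice_sum d m / n%:R) / tau)%:E)%E.
Proof.
have A0 : 0 <= A by have := aA 0; rewrite big_geq.
have M0 : 0 < M%:R :> R by rewrite ltr0n.
have nR : 0 < n%:R :> R by rewrite ltr0n.
(* This [t] cancels the power of [M] in the Dirichlet energy. *)
pose t := tau * (M%:R ^+ 2 / M%:R ^+ d).
have t0 : 0 < t by rewrite mulr_gt0// divr_gt0// exprn_gt0.
pose c (k : grid) : R := (2 * t)^-1 / grid_eigen k.
have c0 k : k != grid0 d m -> 0 <= c k.
  by move=> /(grid_eigen_gt0 (R := R)) k0; rewrite divr_ge0 ?invr_ge0 ?mulr_ge0// ltW.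
pose sq k w : R := (n%:R^-1 * \sum_(j < n)
  (grid_cos k (cell m (Y j w)) - grid_cos k (cell m (X j w)))) ^+ 2.
pose K0 : R := 2 * d%:R / M%:R + d%:R / 2 * tau.
pose V : R := 4 * (2 / M%:R) ^+ d * (1 + 8 * A) / n%:R.
have V0 : 0 <= V.
  have b0 : 0 <= (2 / M%:R) ^+ d :> R by rewrite exprn_ge0// divr_ge0.
  by rewrite /V divr_ge0// !mulr_ge0// addr_ge0// mulr_ge0.
apply: (@le_trans _ _ (\int[P]_w (K0%:E +
    \sum_(k | k != grid0 d m) (c k)%:E * (sq k w)%:E)))%E.
  apply: le_integral_nonmeasurable => w; first exact: W1_ge0.
  have H := @W1_le_cos_coef R d m n (fun k => X k w) (fun k => Y k w) n0 (fun k => X01 k w) (fun k => Y01 k w) t t0.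
  apply: le_trans H _.
  rewrite -(eq_bigr _ (fun k _ => EFinM _ _)) sumEFin -EFinD lee_fin.
  rewrite le_eqVlt; apply/orP; left; apply/eqP; congr (_ + _ + _).
    by rewrite /t; field; rewrite !gt_eqF ?exprn_gt0.
  by rewrite mulr_sumr; apply: eq_bigr => k _; rewrite /c /sq; ring.
have isq k : P.-integrable setT (fun w => (sq k w)%:E : \bar R).
  have mZ j : measurable_fun setT (Z j).
    by apply: measurable_fun_pair; exact: measurable_funPT.
  have H := square_mean_integrable P mZ measurable_cell_pair
    (fun q : grid * grid => grid_cos k q.2 - grid_cos k q.1) n.
  exact: H.
rewrite integralD//; last 2 first.
- exact: finite_measure_integrable_cst.
- by apply: integrable_sum => // k _; exact: integrableZl.
have -> : (\int[P]_w K0%:E = K0%:E)%E.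
  rewrite integral_cst// -[RHS]mule1; congr (_ * _)%E; exact: probability_setT.
rewrite [leRHS]EFinD -/K0 leeD2l//.
rewrite integral_sum// => [|k]; last exact: integrableZl.
apply: (@le_trans _ _ (\sum_(k | k != grid0 d m) (c k * V)%:E)%E).
  apply: lee_sum => k k0; rewrite integralZl// [leRHS]EFinM lee_wpmul2l ?lee_fin ?c0//.
  exact: cos_coef_second_moment.
rewrite sumEFin lee_fin.
apply: (@le_trans _ _ ((2 * t)^-1 * V * (M%:R ^+ 2 * lattice_sum d m))).
  rewrite /lattice_sum !mulr_sumr; apply: ler_sum => k k0.
  rewrite /c mulrAC ler_wpM2l//; first by rewrite mulr_ge0// invr_ge0 mulr_ge0// ltW.
  rewrite -[leRHS]invrK invfM invrK lef_pV2 ?posrE ?grid_eigen_gt0//.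
    by rewrite mulrC grid_eigen_ge.
  by rewrite mulr_gt0 ?invr_gt0 ?exprn_gt0// grid_norm_gt0.
rewrite le_eqVlt; apply/orP; left; apply/eqP.
rewrite /V /t expr_div_n; move: (lattice_sum d m) => S.
by field; rewrite !gt_eqF ?exprn_gt0.
Qed.

End Main.

Theorem corollary4 (R : realType) (disp : measure_display)
    (T : measurableType disp) (P : probability T R) (d : nat)
    (X Y : nat -> {RV P >-> d.-tuple R}) :
  (0 < d)%N ->
  (forall (k : nat) (w : T) (i : 'I_d), 0 <= tnth (X k w) i <= 1) ->
  (forall (k : nat) (w : T) (i : 'I_d), 0 <= tnth (Y k w) i <= 1) ->
  (forall (k : nat) (A : set (d.-tuple R)), measurable A ->
     distribution P (X k) A = distribution P (Y k) A) ->
  (\sum_(1 <= l <oo) mixing P (fun k w => (X k w, Y k w)) l < +oo)%E ->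
  exists C : R, \forall n \near \oo,
    (\int[P]_w W1 (empirical (fun k => X k w) n) (empirical (fun k => Y k w) n)
      <= (C * rate R d n)%:E)%E.
Proof.
move=> d0 X01 Y01 XY summable.
pose Z (k : nat) (w : T) := (X k w, Y k w).
have {}summable : (\sum_(1 <= l <oo) mixing P Z l < +oo)%E by exact: summable.
have mix0 l : (0 <= mixing P Z l)%E.
  apply: (@le_trans _ _ (rosenblatt P (g_sigma_algebra_preimage (Z l))
                     (g_sigma_algebra_preimage (Z 0)))).
    apply: ereal_sup_ge; exists 0%E => //; exists set0, set0.
    by split; [exists set0; rewrite ?setTI|exists set0; rewrite ?setTI|
       rewrite setI0 measure0 mul0e sube0 abse0].
  by apply: ereal_sup_ubound; exists l, 0; split => //; lia.
pose S := (\sum_(1 <= l <oo) mixing P Z l)%E.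
have part p : (\sum_(1 <= l < p) mixing P Z l <= S)%E.
  by apply: nneseries_lim_ge.
have mixfin l : (0 < l)%N -> mixing P Z l = (fine (mixing P Z l))%:E.
  move=> l0; rewrite fineK// ge0_fin_numE//.
  apply: le_lt_trans summable; apply: le_trans (part l.+1).
  by rewrite big_nat_recr//= leeDr// sume_ge0.
have S0 : (0 <= S)%E by have := part 0; rewrite big_geq.
have aA p : \sum_(1 <= l < p) fine (mixing P Z l) <= fine S.
  rewrite -lee_fin fineK ?ge0_fin_numE// -sumEFin.
  rewrite big_seq (eq_bigr (fun l => mixing P Z l)) -?big_seq// => l.
  by rewrite mem_index_iota => /andP[l1 _]; rewrite -mixfin.
have a0 l : 0 <= fine (mixing P Z l) by exact: fine_ge0.
have [C1 [C2 [C10 [C20 size]]]] := @grid_size_rate R d d0.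
exists (2 * d%:R * C1 + d%:R / 2 + 2 * 2 ^+ d * (1 + 8 * fine S) * C2).
near=> n.
have n0 : (0 < n)%N by near: n; exists 1%N.
have [m [r0 hm hS]] : exists m,
    [/\ 0 < rate R d n, m.+1%:R^-1 <= C1 * rate R d n &
        lattice_sum d m / n%:R <= C2 * rate R d n ^+ 2].
  by near: n.
apply: le_trans (expected_W1_le X01 Y01 XY mixfin a0 aA m n0 r0) _.
rewrite lee_fin [leRHS]mulrDl [X in _ <= X + _]mulrDl; apply: lerD; first apply: lerD.
- by rewrite -[leRHS]mulrA ler_wpM2l// mulr_ge0.
- by [].
rewrite ler_pdivrMr//.
have K0 : 0 <= 2 * 2 ^+ d * (1 + 8 * fine S).
  by rewrite mulr_ge0 ?mulr_ge0 ?exprn_ge0 ?addr_ge0 ?mulr_ge0 ?fine_ge0.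
rewrite -[leRHS]mulrA -[leRHS]mulrA ler_wpM2l//.
Unshelve. all: by end_near.
Qed.
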